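(* A function $f\in\tilde C^\infty_e(S^2)$ is recovered from its vertical slice transform by \[ f(x)=\frac{|x_3|}{8\pi^2}\,\Delta\int_{S^1}d\sigma(\theta)\int_{-1}^1(Vf)(\theta,t)\frac{\log|t-\theta\cdot x'|}{\sqrt{1-t^2}}\,dt \] for every $x=(x',x_3)\in S^2$ with $|x'|<1$, where $\Delta$ is the Laplacian in $x'\in\mathbb{R}^2$.
   Context: Points of $\mathbb{R}^3$ are written $x=(x',x_3)$, $x'\in\mathbb{R}^2$; $S^2$ the unit sphere; $S^1$ the unit circle with arc length $d\sigma$. $\tilde C^\infty_e(S^2)$: $C^\infty$ functions on $S^2$ even in $x_3$ and vanishing identically in a neighborhood of the equator $\{x_3=0\}$. Vertical slice transform: $(Vf)(\theta,t)=\int_{\{x\in S^2:x'\cdot\theta=t\}}f(x)\,d_\tau\sigma(x)$ for $\theta\in S^1$, $t\in(-1,1)$, with arc length on the circle of intersection. *)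

(* Defs.v *)
From Stdlib Require Import Reals Lra ClassicalEpsilon.
Open Scope R_scope.

(* Total Riemann integral: the value of RiemannInt when f is Riemann
   integrable on [a,b] (value irrelevant otherwise). *)
Definition Rint (f : R -> R) (a b : R) : R :=
  epsilon (inhabits 0)
    (fun I => exists pr : Riemann_integrable f a b, RiemannInt pr = I).

Definition lim0plus (h : R -> R) : R :=
  epsilon (inhabits 0)
    (fun L => forall e, 0 < e -> exists d, 0 < d /\
       forall s, 0 < s < d -> Rabs (h s - L) < e).

Definition cont3 (F : R -> R -> R -> R) : Prop :=
  forall x1 x2 x3 e, 0 < e -> exists d, 0 < d /\
    forall y1 y2 y3, Rabs (y1 - x1) < d -> Rabs (y2 - x2) < d ->
      Rabs (y3 - x3) < d -> Rabs (F y1 y2 y3 - F x1 x2 x3) < e.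

Fixpoint Ck (n : nat) (F : R -> R -> R -> R) : Prop :=
  match n with
  | O => cont3 F
  | S m => cont3 F /\
      exists D1 D2 D3 : R -> R -> R -> R,
        (forall x1 x2 x3,
           derivable_pt_lim (fun s => F s x2 x3) x1 (D1 x1 x2 x3) /\
           derivable_pt_lim (fun s => F x1 s x3) x2 (D2 x1 x2 x3) /\
           derivable_pt_lim (fun s => F x1 x2 s) x3 (D3 x1 x2 x3)) /\
        Ck m D1 /\ Ck m D2 /\ Ck m D3
  end.

Definition Cinf (F : R -> R -> R -> R) : Prop := forall n, Ck n F.

Definition on_S2 (x1 x2 x3 : R) : Prop := x1 ^ 2 + x2 ^ 2 + x3 ^ 2 = 1.

(* Vertical slice transform, theta = (cos phi, sin phi).  The circle
   {x in S^2 : x'.theta = t} is parametrized as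
   t*theta + r cos psi * theta_perp + r sin psi * e3, r = sqrt(1-t^2),
   psi in [0,2pi], with arc length element r dpsi. *)
Definition Vf (F : R -> R -> R -> R) (phi t : R) : R :=
  let c := cos phi in let s := sin phi in let r := sqrt (1 - t ^ 2) in
  Rint (fun psi => F (t * c - r * cos psi * s) (t * s + r * cos psi * c)
                     (r * sin psi) * r) 0 (2 * PI).

(* Inner (improper, log-singular at t = theta.y) integral over t in (-1,1),
   as the limit of the integral over (-1,1) minus (a-eps,a+eps). *)
Definition inner_int (F : R -> R -> R -> R) (phi y1 y2 : R) : R :=
  let a := cos phi * y1 + sin phi * y2 in
  let g := fun t => Vf F phi t * ln (Rabs (t - a)) / sqrt (1 - t ^ 2) in
  lim0plus (fun eps => Rint g (-1) (a - eps) + Rint g (a + eps) 1).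

Definition Gpot (F : R -> R -> R -> R) (y1 y2 : R) : R :=
  Rint (fun phi => inner_int F phi y1 y2) 0 (2 * PI).

(* Main.v *)
(* The projection of f to the unit disk has density h = f / |x_3|, a smooth
   function of compact support, and (V f)(theta, t) / sqrt (1 - t^2) = 2 (R h)(theta, t)
   with R the Radon transform of the plane.  Integrating by parts against
   ln |t - theta.y| gives a potential whose Laplacian in y is
   -2 * int_theta int_u (R h)''' (theta, theta.y + u) (u ln |u| - u).
   By rotation invariance the theta-average of (R h)(theta, theta.y + u) is
   int_s m (sqrt (u^2 + s^2)) ds, where m (rho) is the integral of h over
   directions at distance rho from y.  Writing m' (rho) = rho k (rho), the two
   integrations by parts back leave the integral over the (u, s)-plane of
   k (sqrt (u^2 + s^2)), which is 2 PI (0 - m (0)) = - 4 PI^2 h (y). *)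
From Coquelicot Require Import Coquelicot.
Require Import Defs.
From Stdlib Require Import Reals Lra ClassicalEpsilon FunctionalExtensionality.
Open Scope R_scope.

(** * Continuity, parametric integrals and Riemann integration *)

(* Coquelicot states equalities of integrals in the carrier of a normed module,
   which [ring] and [field] do not recognize as [R]. *)
Ltac eqR := match goal with |- @eq _ ?a ?b => change (@eq R a b) end.

(** Differentiating the logarithm in [y] would produce non-integrable kernels. The substitution t =
    theta.y + u moves [y] into the smooth factor, so every derivative falls on the Radon transform:
    one from the integration by parts that replaces ln |u| by a continuous antiderivative, two from
    the Laplacian, whose weights cos^2 and sin^2 add up to 1. The derivative of a planar function
    along theta depends on theta, so the calculus is carried out for fields [H phi x y] that carry
    an angle. The delicate point of the way back is u = 0, where ln is singular and sqrt (u^2 + s^2)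
    has a corner when s = 0. Only continuity is used there, and m' (rho) / rho extends continuously
    to 0 because opposite directions cancel and m' (0) = 0. All integrals run over bounded
    intervals: [-2,2] holds whatever is supported in the unit disk, even after recentring at [y]
    with |y| < 1. The integral over the plane is thus one over a square, and the pi that polar
    coordinates would give comes from the integral of 1 / (1 + v^2) over [0,1], which is pi / 4. *)

Lemma locally_intro (x d : R) (P : R -> Prop) :
  0 < d -> (forall y, Rabs (y - x) < d -> P y) -> locally x P.
Proof.
  intros hd H. exists (mkposreal d hd). intros y hy. apply H. exact hy.
Qed.

Lemma continuous_R_spec (U : UniformSpace) (f : U -> R) (x : U) :
  continuous f x <->
  (forall e, 0 < e -> locally x (fun u => Rabs (f u - f x) < e)).
Proof.
  unfold continuous. rewrite filterlim_locally. split.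
  - intros H e he. exact (H (mkposreal e he)).
  - intros H [e he]. exact (H e he).
Qed.

Lemma cont_plus (U : UniformSpace) (f g : U -> R) (x : U) :
  continuous f x -> continuous g x -> continuous (fun u => f u + g u) x.
Proof. intros; apply (continuous_plus (V := R_NormedModule) f g x); assumption. Qed.

Lemma cont_opp (U : UniformSpace) (f : U -> R) (x : U) :
  continuous f x -> continuous (fun u => - f u) x.
Proof. intros; apply (continuous_opp (V := R_NormedModule) f x); assumption. Qed.

Lemma cont_minus (U : UniformSpace) (f g : U -> R) (x : U) :
  continuous f x -> continuous g x -> continuous (fun u => f u - g u) x.
Proof. intros; apply (continuous_minus (V := R_NormedModule) f g x); assumption. Qed.

Lemma cont_mult (U : UniformSpace) (f g : U -> R) (x : U) :
  continuous f x -> continuous g x -> continuous (fun u => f u * g u) x.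
Proof. intros; apply (continuous_mult (K := R_AbsRing) f g x); assumption. Qed.

Lemma cont_comp1 (U : UniformSpace) (phi : R -> R) (f : U -> R) (x : U) :
  continuous f x -> continuous phi (f x) -> continuous (fun u => phi (f u)) x.
Proof. intros; apply (continuous_comp f phi x); assumption. Qed.

Lemma cont_cos (U : UniformSpace) (f : U -> R) (x : U) :
  continuous f x -> continuous (fun u => cos (f u)) x.
Proof. intros; apply cont_comp1; auto using continuous_cos. Qed.

Lemma cont_sin (U : UniformSpace) (f : U -> R) (x : U) :
  continuous f x -> continuous (fun u => sin (f u)) x.
Proof. intros; apply cont_comp1; auto using continuous_sin. Qed.

Lemma cont_sqrt (U : UniformSpace) (f : U -> R) (x : U) :
  continuous f x -> continuous (fun u => sqrt (f u)) x.
Proof. intros; apply cont_comp1; auto using continuous_sqrt. Qed.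

Lemma cont_inv (U : UniformSpace) (f : U -> R) (x : U) :
  f x <> 0 -> continuous f x -> continuous (fun u => / f u) x.
Proof. intros; apply cont_comp1; auto using continuous_Rinv. Qed.

Lemma cont_pow (U : UniformSpace) (f : U -> R) (n : nat) (x : U) :
  continuous f x -> continuous (fun u => f u ^ n) x.
Proof.
  intros H. induction n as [|n IH]; simpl.
  - apply continuous_const.
  - apply cont_mult; assumption.
Qed.

Lemma cont_fst (U V W : UniformSpace) (f : U -> V * W) (x : U) :
  continuous f x -> continuous (fun u => fst (f u)) x.
Proof. intros; apply (continuous_comp f (@fst V W) x); [assumption|destruct (f x); apply continuous_fst]. Qed.

Lemma cont_snd (U V W : UniformSpace) (f : U -> V * W) (x : U) :
  continuous f x -> continuous (fun u => snd (f u)) x.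
Proof. intros; apply (continuous_comp f (@snd V W) x); [assumption|destruct (f x); apply continuous_snd]. Qed.

(* Joint continuity is phrased through composition, so that it can be applied
   to any tuple of continuous arguments without handling product spaces. *)
Definition jcont1 (f : R -> R) : Prop := forall x, continuous f x.
Definition jcont2 (K : R -> R -> R) : Prop :=
  forall (U : UniformSpace) (f g : U -> R) (x : U),
    continuous f x -> continuous g x -> continuous (fun u => K (f u) (g u)) x.
Definition jcont3 (K : R -> R -> R -> R) : Prop :=
  forall (U : UniformSpace) (f g k : U -> R) (x : U),
    continuous f x -> continuous g x -> continuous k x ->
    continuous (fun u => K (f u) (g u) (k u)) x.

Ltac cont_step :=
  match goal with
  | H : continuous ?f ?x |- continuous ?f ?x => exact H
  | H : jcont1 ?f |- continuous ?f _ => apply H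
  | H : jcont1 ?f |- continuous (fun u => ?f (@?g u)) _ => apply (cont_comp1 _ f g); [|apply H]
  | H : jcont2 ?f |- continuous (fun u => ?f (@?g u) (@?k u)) _ => apply H
  | H : jcont2 ?f |- continuous (?f ?a) _ => apply (H _ (fun _ => a) (fun u => u))
  | H : jcont3 ?f |- continuous (?f ?a ?b) _ => apply (H _ (fun _ => a) (fun _ => b) (fun u => u))
  | H : jcont3 ?f |- continuous (fun u => ?f (@?g u) (@?k u) (@?l u)) _ => apply H
  | |- continuous (fun _ => ?c) _ => apply continuous_const
  | |- continuous (fun x => x) _ => apply continuous_id
  | |- continuous (@fst _ _) (_, _) => apply continuous_fst
  | |- continuous (@snd _ _) (_, _) => apply continuous_snd
  | |- continuous (Rmult ?c) ?x => apply (cont_mult _ (fun _ => c) (fun u => u))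
  | |- continuous (Rplus ?c) ?x => apply (cont_plus _ (fun _ => c) (fun u => u))
  | |- continuous (Rminus ?c) ?x => apply (cont_minus _ (fun _ => c) (fun u => u))
  | |- continuous Ropp ?x => apply (cont_opp _ (fun u => u))
  | |- continuous sqrt ?x => apply (cont_sqrt _ (fun u => u))
  | |- continuous cos _ => apply continuous_cos
  | |- continuous sin _ => apply continuous_sin
  | |- continuous (fun u => @fst _ _ (@?f u)) _ => apply cont_fst
  | |- continuous (fun u => @snd _ _ (@?f u)) _ => apply cont_snd
  | |- continuous (fun u => @?f u + @?g u) _ => apply cont_plus
  | |- continuous (fun u => @?f u - @?g u) _ => apply cont_minus
  | |- continuous (fun u => @?f u * @?g u) _ => apply cont_mult
  | |- continuous (fun u => - @?f u) _ => apply cont_opp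
  | |- continuous (fun u => cos (@?f u)) _ => apply cont_cos
  | |- continuous (fun u => sin (@?f u)) _ => apply cont_sin
  | |- continuous (fun u => sqrt (@?f u)) _ => apply cont_sqrt
  | |- continuous (fun u => @?f u ^ ?n) _ => apply cont_pow
  | |- continuous (fun u => / @?f u) _ => apply cont_inv
  | |- continuous (fun u => @?f u / @?g u) _ => unfold Rdiv
  end.
Ltac ct := repeat cont_step.

Lemma cont3_jcont3 (K : R -> R -> R -> R) : cont3 K -> jcont3 K.
Proof.
  intros H U f g k x hf hg hk.
  apply continuous_R_spec. intros e he.
  destruct (H (f x) (g x) (k x) e he) as [d [hd Hd]].
  rewrite continuous_R_spec in hf, hg, hk.
  generalize (filter_and _ _ (hf d hd) (filter_and _ _ (hg d hd) (hk d hd))).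
  apply filter_imp. intros u [h1 [h2 h3]]. apply Hd; assumption.
Qed.

(** * Integrals depending on a parameter *)

Lemma cont_ex_RInt (f : R -> R) (a b : R) : jcont1 f -> ex_RInt f a b.
Proof. intros H. apply (@ex_RInt_continuous R_CompleteNormedModule). intros; apply H. Qed.

(** Compactness of the interval of integration turns joint continuity along [x] into uniform
    closeness of [f u] to [f x]. *)
Lemma continuous_RInt_param (U : UniformSpace) (f : U -> R -> R) (a b : R) (x : U) :
  (forall u, jcont1 (f u)) ->
  (forall t, continuous (fun p : U * R => f (fst p) (snd p)) (x, t)) ->
  continuous (fun u => RInt (f u) a b) x.
Proof.
  intros Hc H.
  assert (Hle : forall a b, a <= b -> continuous (fun u => RInt (f u) a b) x).
  { clear a b. intros a b hab.
    apply continuous_R_spec. intros e he.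
    (* The pointwise bound will be [2 * e'], which integrates to e / 2 times (b - a) / (b - a + 1);
       the added 1 covers [a = b]. *)
    set (e' := e / (4 * (b - a + 1))).
    assert (he' : 0 < e') by (apply Rdiv_lt_0_compat; lra).
    assert (Hd : forall t, {d : posreal | forall u t', ball x d u -> Rabs (t' - t) < d ->
               Rabs (f u t' - f x t) < e'}).
    { intros t. apply constructive_indefinite_description.
      generalize (proj1 (continuous_R_spec _ _ _) (H t) e' he').
      intros [d Hd]. exists d. intros u t' hu ht. apply (Hd (u, t')). split; [exact hu|exact ht]. }
    (* A common radius for the cover by local windows. Membership in a window is given only under a
       double negation, which is enough to prove the decidable inequality [Hpt]. *)
    destruct (compactness_value_1d a b (fun t => proj1_sig (Hd t))) as [d Hdd].
    exists d. intros u hu.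
    assert (Hpt : forall t, a <= t <= b -> Rabs (f u t - f x t) <= 2 * e').
    { intros t ht. destruct (Rle_dec (Rabs (f u t - f x t)) (2 * e')) as [h|h]; [exact h|].
      exfalso. apply (Hdd t ht). intros [s [hs [h1 h2]]]. apply h.
      destruct (Hd s) as [ds Hds]; simpl in *.
      assert (A := Hds u t (ball_le x d ds h2 u hu) h1).
      assert (B := Hds x t (ball_center x ds) h1).
      replace (f u t - f x t) with ((f u t - f x s) - (f x t - f x s)) by ring.
      eapply Rle_trans; [apply Rabs_triang|]. rewrite Rabs_Ropp. lra. }
    assert (E : RInt (f u) a b - RInt (f x) a b = RInt (fun t => f u t - f x t) a b).
    { symmetry. apply (RInt_minus (V := R_CompleteNormedModule)); apply cont_ex_RInt, Hc. }
    rewrite E.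
    eapply Rle_lt_trans.
    { apply abs_RInt_le_const with (M := 2 * e'); auto.
      apply cont_ex_RInt. intros t. apply cont_minus; apply Hc. }
    unfold e'.
    apply Rle_lt_trans with (e / 2 * ((b - a) / (b - a + 1))).
    - right. field. lra.
    - assert ((b - a) / (b - a + 1) < 1).
      { apply Rmult_lt_reg_r with (b - a + 1); [lra|]. field_simplify; lra. }
      assert (0 <= (b - a) / (b - a + 1)).
      { apply Rmult_le_pos; [lra|]. left; apply Rinv_0_lt_compat; lra. }
      nra. }
  destruct (Rle_dec a b) as [hab|hab].
  - auto.
  - apply (continuous_ext (fun u => - RInt (f u) b a)).
    + intros u. apply (opp_RInt_swap (V := R_CompleteNormedModule)). apply cont_ex_RInt, Hc.
    + apply cont_opp, Hle. lra.
Qed.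

Lemma jcont2_RInt (K : R -> R -> R -> R) (a b : R) :
  jcont3 K -> jcont2 (fun x y => RInt (K x y) a b).
Proof.
  intros H U f g x hf hg.
  apply (continuous_RInt_param U (fun u t => K (f u) (g u) t)).
  - intros u t. apply H; ct.
  - intros t. apply (H _ (fun p : U * R => f (fst p)) (fun p => g (fst p)) snd).
    + apply (continuous_comp fst f); [apply continuous_fst|exact hf].
    + apply (continuous_comp fst g); [apply continuous_fst|exact hg].
    + apply continuous_snd.
Qed.

Lemma jcont1_RInt (K : R -> R -> R) (a b : R) :
  jcont2 K -> jcont1 (fun x => RInt (K x) a b).
Proof.
  intros H x.
  apply (continuous_RInt_param R_UniformSpace K).
  - intros u t. apply H; ct.
  - intros t. apply H; ct.
Qed.

(** The derivative is required only within distance [d] of [x]; this permits differentiation under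
    the integral at points u <> 0 when the integrand has a corner at u = 0. *)
Lemma is_derive_RInt_param_loc (f f' : R -> R -> R) (a b x d : R) :
  0 < d ->
  (forall y t, Rabs (y - x) < d -> is_derive (fun z => f z t) y (f' y t)) ->
  (forall y, Rabs (y - x) < d -> jcont1 (f y)) ->
  (forall t, continuous (fun p : R * R => f' (fst p) (snd p)) (x, t)) ->
  is_derive (fun z => RInt (f z) a b) x (RInt (f' x) a b).
Proof.
  intros hd Hd Hc Hc'.
  assert (E : RInt (f' x) a b = RInt (fun t => Derive (fun u => f u t) x) a b).
  { apply (RInt_ext (V := R_CompleteNormedModule)). intros t _. symmetry. apply is_derive_unique, Hd.
    rewrite Rminus_diag, Rabs_R0. exact hd. }
  rewrite E.
  apply is_derive_RInt_param.
  - apply (locally_intro x d); [exact hd|]. intros y hy t _. exists (f' y t). auto.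
  - intros t _. apply continuity_2d_pt_ext_loc with f'.
    + exists (mkposreal d hd). intros u v hu _. symmetry. apply is_derive_unique, Hd, hu.
    + apply continuity_2d_pt_filterlim. apply Hc'.
  - apply (locally_intro x d); [exact hd|]. intros y hy. apply cont_ex_RInt, Hc, hy.
Qed.

Lemma is_derive_RInt_jcont (f f' : R -> R -> R) (a b x : R) :
  (forall y t, is_derive (fun z => f z t) y (f' y t)) ->
  jcont2 f -> jcont2 f' ->
  is_derive (fun z => RInt (f z) a b) x (RInt (f' x) a b).
Proof.
  intros Hd Hc Hc'.
  apply is_derive_RInt_param_loc with 1; auto.
  - lra.
  - intros y _ t. apply Hc; ct.
  - intros t. apply Hc'; ct.
Qed.

(** * Rules for the Riemann integral of continuous functions *)

Lemma RIntR_ext (f g : R -> R) (a b : R) :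
  (forall x, a <= x <= b -> f x = g x) -> a <= b -> RInt f a b = RInt g a b :> R.
Proof.
  intros H hab. apply (RInt_ext (V := R_CompleteNormedModule)).
  rewrite Rmin_left, Rmax_right by lra. intros x hx; apply H; lra.
Qed.

Lemma RIntR_ext_all (f g : R -> R) (a b : R) :
  (forall x, f x = g x) -> RInt f a b = RInt g a b :> R.
Proof. intros H. apply (RInt_ext (V := R_CompleteNormedModule)). intros; apply H. Qed.

Lemma RIntR_plus (f g : R -> R) (a b : R) :
  jcont1 f -> jcont1 g ->
  RInt (fun x => f x + g x) a b = RInt f a b + RInt g a b :> R.
Proof. intros; apply (RInt_plus (V := R_CompleteNormedModule)); apply cont_ex_RInt; assumption. Qed.

Lemma RIntR_scal (f : R -> R) (l a b : R) :
  jcont1 f -> RInt (fun x => l * f x) a b = l * RInt f a b :> R.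
Proof. intros; apply (RInt_scal (V := R_CompleteNormedModule)); apply cont_ex_RInt; assumption. Qed.

Lemma RIntR_Chasles (f : R -> R) (a b c : R) :
  jcont1 f -> RInt f a b + RInt f b c = RInt f a c :> R.
Proof. intros; apply (RInt_Chasles (V := R_CompleteNormedModule)); apply cont_ex_RInt; assumption. Qed.

Lemma RIntR_const (l a b : R) : RInt (fun _ => l) a b = (b - a) * l :> R.
Proof. apply (RInt_const (V := R_CompleteNormedModule)). Qed.

Lemma RIntR_point (f : R -> R) (a : R) : RInt f a a = 0 :> R.
Proof. apply (RInt_point (V := R_CompleteNormedModule)). Qed.

Lemma is_derive_RInt_bound (f : R -> R) (a x : R) :
  jcont1 f -> is_derive (fun z => RInt f a z) x (f x).
Proof.
  intros H. apply (is_derive_RInt (V := R_NormedModule) f _ a).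
  - apply (locally_intro x 1); [lra|]. intros y _.
    apply (RInt_correct (V := R_CompleteNormedModule)), cont_ex_RInt, H.
  - apply H.
Qed.

Lemma is_derive_cont (f : R -> R) (x l : R) : is_derive f x l -> continuous f x.
Proof. intros H. apply (ex_derive_continuous (V := R_NormedModule)). exists l. exact H. Qed.

Lemma is_derive_minus_same (f g : R -> R) (x l : R) :
  is_derive f x l -> is_derive g x l -> is_derive (fun s => f s - g s) x 0.
Proof.
  intros Hf Hg. rewrite <- (Rminus_diag l).
  apply (is_derive_minus (V := R_NormedModule)); assumption.
Qed.

Lemma zero_derive_const (f : R -> R) (a b : R) :
  a < b ->
  (forall x, a < x < b -> is_derive f x 0) ->
  (forall x, a <= x <= b -> continuous f x) ->
  f a = f b.
Proof.
  intros hab Hd Hc.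
  destruct (MVT_gen f a b (fun _ => 0)) as [c [_ E]].
  - rewrite Rmin_left, Rmax_right by lra. exact Hd.
  - rewrite Rmin_left, Rmax_right by lra. intros x hx.
    apply continuity_pt_filterlim, Hc, hx.
  - lra.
Qed.

Lemma zero_derive_global (f : R -> R) (a b : R) :
  (forall x, is_derive f x 0) -> f a = f b.
Proof.
  intros H. destruct (Rtotal_order a b) as [h|[h|h]].
  - apply zero_derive_const; auto. intros; eapply is_derive_cont, H.
  - congruence.
  - symmetry. apply zero_derive_const; auto. intros; eapply is_derive_cont, H.
Qed.

(** [F] minus the indefinite integral of [f] has zero derivative inside. Differentiability is asked
    only in the open interval, since antiderivatives built from [elog] are merely known to be
    continuous at the endpoint 0. *)
Lemma RInt_newton (F f : R -> R) (a b : R) :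
  a <= b -> jcont1 f ->
  (forall x, a < x < b -> is_derive F x (f x)) ->
  (forall x, a <= x <= b -> continuous F x) ->
  RInt f a b = F b - F a :> R.
Proof.
  intros hab Hf Hd Hc.
  destruct hab as [hab|hab].
  2: { subst b. rewrite RIntR_point. ring. }
  assert (E := zero_derive_const (fun x => F x - RInt f a x) a b hab).
  cbv beta in E. rewrite RIntR_point in E.
  enough (F a - 0 = F b - RInt f a b) by lra.
  apply E.
  - intros x hx. apply (is_derive_minus_same F (fun x => RInt f a x) x (f x)).
    + apply Hd, hx.
    + apply is_derive_RInt_bound, Hf.
  - intros x hx. apply cont_minus; [apply Hc, hx|].
    eapply is_derive_cont, is_derive_RInt_bound, Hf.
Qed.

(** As functions of the upper limit of the [x]-integral, both sides have the same derivative and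
    vanish at [a]. *)
Lemma RInt_Fubini (f : R -> R -> R) (a b c d : R) :
  jcont2 f ->
  RInt (fun x => RInt (f x) c d) a b = RInt (fun y => RInt (fun x => f x y) a b) c d :> R.
Proof.
  intros H.
  set (D := fun z => RInt (fun x => RInt (f x) c d) a z - RInt (fun y => RInt (fun x => f x y) a z) c d).
  assert (HD : D a = D b).
  { apply zero_derive_global. intros z. unfold D.
    apply (is_derive_minus_same (fun z => RInt (fun x => RInt (f x) c d) a z)
             (fun z => RInt (fun y => RInt (fun x => f x y) a z) c d) z (RInt (f z) c d)).
    - apply (is_derive_RInt_bound (fun x => RInt (f x) c d)). apply jcont1_RInt, H.
    - apply (is_derive_RInt_param_loc (fun z y => RInt (fun x => f x y) a z) f c d z 1).
      + lra.
      + intros y t _. apply (is_derive_RInt_bound (fun x => f x t)). intros x. apply H; ct.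
      + intros y _. apply (jcont1_RInt (fun t x => f x t)). intros U p q x hp hq. apply H; assumption.
      + intros t. apply H; ct. }
  unfold D in HD. rewrite RIntR_point in HD.
  rewrite (RIntR_ext_all (fun y => RInt (fun x => f x y) a a) (fun _ => 0)) in HD
    by (intros; apply RIntR_point).
  rewrite RIntR_const in HD. lra.
Qed.

Lemma RIntR_zero (f : R -> R) (a b : R) :
  a <= b -> (forall x, a <= x <= b -> f x = 0) -> RInt f a b = 0 :> R.
Proof.
  intros hab H. rewrite (RIntR_ext f (fun _ => 0)) by auto. rewrite RIntR_const. apply Rmult_0_r.
Qed.

Lemma RIntR_comp_lin (f : R -> R) (u v a b : R) :
  jcont1 f -> RInt (fun y => u * f (u * y + v)) a b = RInt f (u * a + v) (u * b + v) :> R.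
Proof.
  intros H. apply (RInt_comp_lin (V := R_CompleteNormedModule)). apply cont_ex_RInt, H.
Qed.

Lemma RIntR_shift (f : R -> R) (v a b : R) :
  jcont1 f -> RInt (fun y => f (y + v)) a b = RInt f (a + v) (b + v) :> R.
Proof.
  intros H. replace (a + v) with (1 * a + v) by ring. replace (b + v) with (1 * b + v) by ring.
  rewrite <- RIntR_comp_lin by exact H. apply RIntR_ext_all. intros. rewrite !Rmult_1_l. reflexivity.
Qed.

Lemma RIntR_flip (f : R -> R) (v a b : R) :
  jcont1 f -> RInt (fun y => f (v - y)) a b = RInt f (v - b) (v - a) :> R.
Proof.
  intros H.
  assert (E := RIntR_comp_lin f (-1) v a b H).
  rewrite RIntR_scal in E.
  2: { intros x. ct. }
  rewrite (RIntR_ext_all (fun y => f (v - y)) (fun y => f (-1 * y + v))) by (intros; f_equal; ring).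
  replace (-1 * a + v) with (v - a) in E by ring. replace (-1 * b + v) with (v - b) in E by ring.
  assert (E2 := RIntR_Chasles f (v - a) (v - b) (v - a) H).
  rewrite RIntR_point in E2. lra.
Qed.

Lemma RIntR_even (f : R -> R) (L : R) :
  jcont1 f -> (forall x, f (- x) = f x) -> RInt f (- L) L = 2 * RInt f 0 L :> R.
Proof.
  intros H He. rewrite <- (RIntR_Chasles f (- L) 0 L) by exact H.
  assert (E := RIntR_flip f 0 0 L H).
  replace (0 - L) with (- L) in E by ring. rewrite Rminus_0_r in E. rewrite <- E.
  rewrite (RIntR_ext_all (fun y => f (0 - y)) f).
  - ring.
  - intros. rewrite <- (He x). f_equal. ring.
Qed.

Lemma RIntR_support (f : R -> R) (a b c d : R) :
  jcont1 f -> a <= b -> c <= a -> b <= d ->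
  (forall x, x <= a \/ b <= x -> f x = 0) -> RInt f c d = RInt f a b :> R.
Proof.
  intros H hab h1 h2 Hz.
  rewrite <- (RIntR_Chasles f c a d), <- (RIntR_Chasles f a b d) by exact H.
  rewrite (RIntR_zero f c a), (RIntR_zero f b d); try lra; intros; apply Hz; lra.
Qed.

(** The window [-2,2] still covers the support [-1,1] after a shift by at most 1; this slack is why
    the integrals over lines use 2 as their bound. *)
Lemma RIntR_shift_support (f : R -> R) (v : R) :
  jcont1 f -> -1 <= v <= 1 ->
  (forall x, 1 <= Rabs x -> f x = 0) ->
  RInt (fun y => f (y + v)) (-2) 2 = RInt f (-2) 2 :> R.
Proof.
  intros H hv Hz. rewrite RIntR_shift by exact H.
  assert (Z : forall x, x <= -1 \/ 1 <= x -> f x = 0).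
  { intros x hx. apply Hz. destruct hx; [rewrite Rabs_left by lra|rewrite Rabs_right by lra]; lra. }
  rewrite (RIntR_support f (-1) 1 (-2 + v)), (RIntR_support f (-1) 1 (-2)) by (assumption || lra).
  reflexivity.
Qed.

Lemma RIntR_periodic (f : R -> R) (T b : R) :
  jcont1 f -> (forall x, f (x + T) = f x) ->
  RInt (fun x => f (x + b)) 0 T = RInt f 0 T :> R.
Proof.
  intros H Hp. rewrite RIntR_shift by exact H.
  assert (E := RIntR_shift f T 0 b H).
  rewrite (RIntR_ext_all (fun y => f (y + T)) f) in E by auto.
  rewrite Rplus_0_l in *. rewrite (Rplus_comm T b).
  assert (A := RIntR_Chasles f 0 b (b + T) H).
  assert (B := RIntR_Chasles f 0 T (b + T) H).
  lra.
Qed.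

(** * Values of the integral and the limit defined by [epsilon] *)

Lemma Rint_RInt (f : R -> R) (a b : R) : ex_RInt f a b -> Rint f a b = RInt f a b.
Proof.
  intros H. unfold Rint.
  assert (Hex : exists I, exists pr : Riemann_integrable f a b, RiemannInt pr = I).
  { exists (RiemannInt (ex_RInt_Reals_0 f a b H)), (ex_RInt_Reals_0 f a b H). reflexivity. }
  destruct (epsilon_spec (inhabits 0) _ Hex) as [pr E].
  rewrite <- E. symmetry. apply RInt_Reals.
Qed.

Lemma Rint_RInt_ext (f g : R -> R) (a b : R) :
  a <= b -> jcont1 g -> (forall x, a <= x <= b -> f x = g x) -> Rint f a b = RInt g a b.
Proof.
  intros hab H E. rewrite Rint_RInt.
  - apply RIntR_ext; auto.
  - apply (ex_RInt_ext (V := R_NormedModule) g).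
    + rewrite Rmin_left, Rmax_right by lra. intros x hx. symmetry. apply E. lra.
    + apply cont_ex_RInt, H.
Qed.

(** [lim0plus] picks some limit, so its value is determined by existence, supplied by a continuous
    extension [S], together with uniqueness. *)
Lemma lim0plus_continuous (h S : R -> R) (d : R) :
  0 < d -> continuous S 0 -> (forall s, 0 < s < d -> h s = S s) -> lim0plus h = S 0.
Proof.
  intros hd HS E. unfold lim0plus.
  set (P := fun L => forall e, 0 < e -> exists d, 0 < d /\ forall s, 0 < s < d -> Rabs (h s - L) < e).
  assert (HP : P (S 0)).
  { intros e he. destruct (proj1 (continuous_R_spec _ _ _) HS e he) as [[d' hd'] Hd'].
    exists (Rmin d d'). split; [apply Rmin_pos; assumption|].
    intros s hs. assert (h1 := Rmin_l d d'). assert (h2 := Rmin_r d d').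
    rewrite E by lra. apply Hd'. change (Rabs (s - 0) < d'). rewrite Rabs_right; lra. }
  assert (HQ := epsilon_spec (inhabits 0) P (ex_intro _ _ HP)).
  set (L := epsilon (inhabits 0) P) in *.
  destruct (Req_dec L (S 0)) as [E0|E0]; [exact E0|exfalso].
  assert (he : 0 < Rabs (L - S 0) / 2) by (assert (0 < Rabs (L - S 0)) by (apply Rabs_pos_lt; lra); lra).
  destruct (HP _ he) as [d1 [hd1 H1]]. destruct (HQ _ he) as [d2 [hd2 H2]].
  set (s := Rmin d1 d2 / 2).
  assert (hs : 0 < s < d1 /\ s < d2).
  { unfold s. assert (h1 := Rmin_l d1 d2). assert (h2 := Rmin_r d1 d2).
    assert (0 < Rmin d1 d2) by (apply Rmin_pos; assumption). lra. }
  assert (A := H1 s ltac:(lra)). assert (B := H2 s ltac:(lra)).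
  assert (C : Rabs (L - S 0) <= Rabs (h s - S 0) + Rabs (h s - L)).
  { replace (L - S 0) with ((h s - S 0) - (h s - L)) by ring.
    eapply Rle_trans; [apply Rabs_triang|]. rewrite Rabs_Ropp. lra. }
  lra.
Qed.

(** * Smooth functions on planar domains *)

(** Joint continuity of [h1] upgrades the two partial derivatives to a total differential, to which
    the chain rule applies. *)
Lemma is_derive_comp2 (h h1 h2 : R -> R -> R) (p q : R -> R) (t p' q' : R) :
  (forall x y, is_derive (fun s => h s y) x (h1 x y)) ->
  (forall x y, is_derive (fun s => h x s) y (h2 x y)) ->
  jcont2 h1 ->
  is_derive p t p' -> is_derive q t q' ->
  is_derive (fun s => h (p s) (q s)) t (h1 (p t) (q t) * p' + h2 (p t) (q t) * q').
Proof.
  intros H1 H2 Hc Hp Hq.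
  apply is_derive_Reals.
  apply derivable_pt_lim_comp_2d; try (apply is_derive_Reals; assumption).
  apply filterdiff_differentiable_pt_lim.
  apply (is_derive_filterdiff h (p t) (q t) h1 (h2 (p t) (q t))).
  - apply filter_forall. intros u. apply H1.
  - apply H2.
  - apply Hc; ct.
Qed.

(** Only the value at the point [x] itself has to lie in [D]. For an open [D] this is continuity at
    the points of [D] of a function that is defined everywhere. *)
Definition contOn (D : R -> R -> Prop) (h : R -> R -> R) : Prop :=
  forall (U : UniformSpace) (f g : U -> R) (x : U),
    D (f x) (g x) -> continuous f x -> continuous g x ->
    continuous (fun u => h (f u) (g u)) x.

Fixpoint CkOn (n : nat) (D : R -> R -> Prop) (h : R -> R -> R) : Prop :=
  contOn D h /\
  match n with
  | O => True
  | S m => exists h1 h2,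
      (forall x y, D x y -> is_derive (fun s => h s y) x (h1 x y) /\
                            is_derive (fun s => h x s) y (h2 x y)) /\
      CkOn m D h1 /\ CkOn m D h2
  end.

Lemma CkOn_cont n D h : CkOn n D h -> contOn D h.
Proof. destruct n; intros [H _]; exact H. Qed.

(** Product and chain rules reproduce the function itself next to its derivatives, so it is needed
    one order lower as well. *)
Lemma CkOn_pred n D h : CkOn (S n) D h -> CkOn n D h.
Proof.
  revert h. induction n as [|n IH]; intros h [H0 [h1 [h2 [Hd [H1 H2]]]]].
  - split; auto.
  - split; [exact H0|]. exists h1, h2. auto.
Qed.

Lemma CkOn_ext n D h k : (forall x y, h x y = k x y) -> CkOn n D h -> CkOn n D k.
Proof.
  intros E H. replace k with h; [exact H|].
  apply functional_extensionality; intros x. apply functional_extensionality; intros y. apply E.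
Qed.

Lemma CkOn_const n D c : CkOn n D (fun _ _ => c).
Proof.
  revert c. induction n as [|n IH]; intros c; (split; [intros U f g x _ _ _; ct|]); auto.
  exists (fun _ _ => 0), (fun _ _ => 0). split; [|auto].
  intros x y _. split; apply (is_derive_const (V := R_NormedModule)).
Qed.

Lemma CkOn_fst n D : CkOn n D (fun x _ => x).
Proof.
  destruct n; (split; [intros U f g x _ ? ?; ct|]); auto.
  exists (fun _ _ => 1), (fun _ _ => 0). split; [|split; apply CkOn_const].
  intros x y _. split; [apply (is_derive_id (K := R_AbsRing))|apply (is_derive_const (V := R_NormedModule))].
Qed.

Lemma CkOn_snd n D : CkOn n D (fun _ y => y).
Proof.
  destruct n; (split; [intros U f g x _ ? ?; ct|]); auto.
  exists (fun _ _ => 0), (fun _ _ => 1). split; [|split; apply CkOn_const].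
  intros x y _. split; [apply (is_derive_const (V := R_NormedModule))|apply (is_derive_id (K := R_AbsRing))].
Qed.

Lemma CkOn_plus n D h k : CkOn n D h -> CkOn n D k -> CkOn n D (fun x y => h x y + k x y).
Proof.
  revert h k. induction n as [|n IH]; intros h k [H0 H] [K0 K];
    (split; [intros U f g x hx hf hg; apply cont_plus; [apply H0|apply K0]; assumption|]); auto.
  destruct H as [h1 [h2 [Hd [H1 H2]]]]. destruct K as [k1 [k2 [Kd [K1 K2]]]].
  exists (fun x y => h1 x y + k1 x y), (fun x y => h2 x y + k2 x y). split; [|auto].
  intros x y hxy. destruct (Hd x y hxy), (Kd x y hxy).
  split; apply (is_derive_plus (V := R_NormedModule)); assumption.
Qed.

Lemma is_derive_multR (f g : R -> R) (x f' g' : R) :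
  is_derive f x f' -> is_derive g x g' ->
  is_derive (fun s => f s * g s) x (f' * g x + f x * g').
Proof.
  intros Hf Hg. apply (is_derive_mult (K := R_AbsRing) f g x f' g' Hf Hg).
  intros; apply Rmult_comm.
Qed.

Lemma CkOn_mult n D h k : CkOn n D h -> CkOn n D k -> CkOn n D (fun x y => h x y * k x y).
Proof.
  revert h k. induction n as [|n IH]; intros h k H' K';
    assert (H0 := CkOn_cont _ _ _ H'); assert (K0 := CkOn_cont _ _ _ K');
    (split; [intros U f g x hx hf hg; apply cont_mult; [apply H0|apply K0]; assumption|]); auto.
  assert (Hn := CkOn_pred _ _ _ H'). assert (Kn := CkOn_pred _ _ _ K').
  destruct H' as [_ [h1 [h2 [Hd [H1 H2]]]]]. destruct K' as [_ [k1 [k2 [Kd [K1 K2]]]]].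
  exists (fun x y => h1 x y * k x y + h x y * k1 x y), (fun x y => h2 x y * k x y + h x y * k2 x y).
  split; [|split; apply CkOn_plus; apply IH; assumption].
  intros x y hxy. destruct (Hd x y hxy), (Kd x y hxy).
  split.
  - apply (is_derive_multR (fun s => h s y) (fun s => k s y)); assumption.
  - apply (is_derive_multR (fun s => h x s) (fun s => k x s)); assumption.
Qed.

Lemma Ck_cont n F : Ck n F -> jcont3 F.
Proof. intros H. apply cont3_jcont3. destruct n; [exact H|exact (proj1 H)]. Qed.

Lemma CkOn_comp n D F w :
  Ck n F -> CkOn n D w -> CkOn n D (fun x y => F x y (w x y)).
Proof.
  revert F. induction n as [|n IH]; intros F HF Hw;
    assert (F0 := Ck_cont _ _ HF); assert (w0 := CkOn_cont _ _ _ Hw);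
    (split; [intros U f g x hx hf hg; apply F0; auto|]); auto.
  assert (Hw' := CkOn_pred _ _ _ Hw).
  destruct HF as [_ [D1 [D2 [D3 [Hd [H1 [H2 H3]]]]]]].
  destruct Hw as [_ [w1 [w2 [Wd [W1 W2]]]]].
  exists (fun x y => D1 x y (w x y) + D3 x y (w x y) * w1 x y),
         (fun x y => D2 x y (w x y) + D3 x y (w x y) * w2 x y).
  split; [|split; apply CkOn_plus; try apply CkOn_mult; auto].
  assert (C1 := Ck_cont _ _ H1). assert (C2 := Ck_cont _ _ H2).
  intros x y hxy. destruct (Wd x y hxy) as [d1 d2]. split.
  - replace (D1 x y (w x y)) with (D1 x y (w x y) * 1) by ring.
    apply (is_derive_comp2 (fun a b => F a y b) (fun a b => D1 a y b) (fun a b => D3 a y b)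
             (fun s => s) (fun s => w s y)).
    + intros a b. apply is_derive_Reals, Hd.
    + intros a b. apply is_derive_Reals, Hd.
    + intros U f g u hf hg. ct.
    + apply (is_derive_id (K := R_AbsRing)).
    + exact d1.
  - replace (D2 x y (w x y)) with (D2 x y (w x y) * 1) by ring.
    apply (is_derive_comp2 (fun a b => F x a b) (fun a b => D2 x a b) (fun a b => D3 x a b)
             (fun s => s) (fun s => w x s)).
    + intros a b. apply is_derive_Reals, Hd.
    + intros a b. apply is_derive_Reals, Hd.
    + intros U f g u hf hg. ct.
    + apply (is_derive_id (K := R_AbsRing)).
    + exact d2.
Qed.

(** * The density of the projection to the unit disk *)

Definition disk (x y : R) : Prop := x ^ 2 + y ^ 2 < 1.
(** The reciprocal of the height is the convenient generator: its partial derivatives are [x] and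
    [y] times its cube, so smoothness follows by induction from the product rule. The height itself
    is recovered as 1 - |x'|^2 times it. *)
Definition invheight (x y : R) : R := / sqrt (1 - (x ^ 2 + y ^ 2)).

Lemma CkOn_invheight n : CkOn n disk invheight.
Proof.
  assert (Hc : contOn disk invheight).
  { intros U f g x hx hf hg. unfold invheight, disk in *. ct.
    apply Rgt_not_eq, sqrt_lt_R0. lra. }
  induction n as [|n IH]; (split; [exact Hc|]); auto.
  exists (fun x y => x * (invheight x y * (invheight x y * invheight x y))),
         (fun x y => y * (invheight x y * (invheight x y * invheight x y))).
  split; [|split; repeat apply CkOn_mult; auto using CkOn_fst, CkOn_snd].
  intros x y hxy. unfold disk in hxy. unfold invheight.
  assert (hs : 0 < sqrt (1 - (x ^ 2 + y ^ 2))) by (apply sqrt_lt_R0; lra).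
  split; auto_derive;
    change (1 + - (x * (x * 1) + y * (y * 1))) with (1 - (x ^ 2 + y ^ 2)).
  - repeat split; lra.
  - field. lra.
  - repeat split; lra.
  - field. lra.
Qed.

Definition plane (x y : R) : Prop := True.

Definition glue (h : R -> R -> R) (x y : R) : R :=
  if Rlt_dec (x ^ 2 + y ^ 2) 1 then h x y else 0.

(* The density [f(x) / |x_3|] of the projection of [f] to the disk, extended by
   zero. *)
Definition proj_density (F : R -> R -> R -> R) : R -> R -> R :=
  glue (fun x y => F x y ((1 - (x ^ 2 + y ^ 2)) * invheight x y) * invheight x y).

Lemma locally_lt (U : UniformSpace) (f : U -> R) (x : U) (m : R) :
  continuous f x -> f x < m -> locally x (fun s => f s < m).
Proof.
  intros H hm.
  generalize (proj1 (continuous_R_spec _ _ _) H (m - f x) ltac:(lra)).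
  apply filter_imp. intros u hu. apply Rabs_def2 in hu. lra.
Qed.

Lemma locally_gt (U : UniformSpace) (f : U -> R) (x : U) (m : R) :
  continuous f x -> m < f x -> locally x (fun s => m < f s).
Proof.
  intros H hm.
  generalize (proj1 (continuous_R_spec _ _ _) H (f x - m) ltac:(lra)).
  apply filter_imp. intros u hu. apply Rabs_def2 in hu. lra.
Qed.

Lemma glue_in h x y : x ^ 2 + y ^ 2 < 1 -> glue h x y = h x y.
Proof. intros H. unfold glue. destruct (Rlt_dec _ _); tauto. Qed.

Lemma glue_out h m x y :
  (forall x y, disk x y -> m < x ^ 2 + y ^ 2 -> h x y = 0) -> m < x ^ 2 + y ^ 2 -> glue h x y = 0.
Proof. intros H hm. unfold glue. destruct (Rlt_dec _ _); auto. Qed.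

Lemma derive_zero_near (f : R -> R) (x l : R) :
  locally x (fun s => f s = 0) -> is_derive f x l -> l = 0.
Proof.
  intros Hz Hd. rewrite <- (is_derive_unique _ _ _ Hd).
  rewrite (Derive_ext_loc f (fun _ => 0)) by exact Hz. apply Derive_const.
Qed.

(** A point with |x'|^2 >= 1 has a neighborhood with |x'|^2 > m on which the glued function is zero,
    so no singularity at the rim survives. The partial derivatives also vanish where m < |x'|^2 < 1,
    which keeps the induction going. *)
Lemma CkOn_glue n h m :
  m < 1 -> CkOn n disk h ->
  (forall x y, disk x y -> m < x ^ 2 + y ^ 2 -> h x y = 0) ->
  CkOn n plane (glue h).
Proof.
  intros hm. revert h. induction n as [|n IH]; intros h H Hz;
    assert (H0 := CkOn_cont _ _ _ H);
    (split;
     [intros U f g x _ hf hg;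
      destruct (Rlt_dec (f x ^ 2 + g x ^ 2) 1) as [hin|hout];
      [ apply (continuous_ext_loc _ (fun u => h (f u) (g u)));
        [ generalize (locally_lt U (fun u => f u ^ 2 + g u ^ 2) x 1 ltac:(ct) hin);
          apply filter_imp; intros u hu; symmetry; apply glue_in, hu
        | apply H0; assumption ]
      | apply (continuous_ext_loc _ (fun u => 0));
        [ generalize (locally_gt U (fun u => f u ^ 2 + g u ^ 2) x m ltac:(ct) ltac:(lra));
          apply filter_imp; intros u hu; symmetry; apply (glue_out h m); assumption
        | ct ] ]
     |]); auto.
  assert (c1 : forall x y : R, continuous (fun s : R => s ^ 2 + y ^ 2) x) by (intros; ct).
  assert (c2 : forall x y : R, continuous (fun s : R => x ^ 2 + s ^ 2) y) by (intros; ct).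
  destruct H as [_ [h1 [h2 [Hd [H1 H2]]]]].
  assert (Z1 : forall x y, disk x y -> m < x ^ 2 + y ^ 2 -> h1 x y = 0).
  { intros x y hx hmx. apply (derive_zero_near (fun s => h s y) x); [|apply Hd, hx].
    generalize (filter_and _ _ (locally_lt R_UniformSpace _ x 1 (c1 x y) hx)
                               (locally_gt R_UniformSpace _ x m (c1 x y) hmx)).
    apply filter_imp. intros s [A B]. apply Hz; assumption. }
  assert (Z2 : forall x y, disk x y -> m < x ^ 2 + y ^ 2 -> h2 x y = 0).
  { intros x y hx hmx. apply (derive_zero_near (fun s => h x s) y); [|apply Hd, hx].
    generalize (filter_and _ _ (locally_lt R_UniformSpace _ y 1 (c2 x y) hx)
                               (locally_gt R_UniformSpace _ y m (c2 x y) hmx)).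
    apply filter_imp. intros s [A B]. apply Hz; assumption. }
  exists (glue h1), (glue h2). split; [|auto].
  intros x y _. destruct (Rlt_dec (x ^ 2 + y ^ 2) 1) as [hin|hout].
  - rewrite !glue_in by exact hin. split.
    + apply (is_derive_ext_loc (fun s => h s y)); [|apply Hd, hin].
      generalize (locally_lt R_UniformSpace _ x 1 (c1 x y) hin).
      apply filter_imp. intros s hs. symmetry. apply glue_in, hs.
    + apply (is_derive_ext_loc (fun s => h x s)); [|apply Hd, hin].
      generalize (locally_lt R_UniformSpace _ y 1 (c2 x y) hin).
      apply filter_imp. intros s hs. symmetry. apply glue_in, hs.
  - rewrite (glue_out h1 m x y Z1), (glue_out h2 m x y Z2) by lra. split.
    + apply (is_derive_ext_loc (fun s => 0)); [|apply (is_derive_const (V := R_NormedModule))].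
      generalize (locally_gt R_UniformSpace _ x m (c1 x y) ltac:(lra)).
      apply filter_imp. intros s hs. symmetry. apply (glue_out h m); assumption.
    + apply (is_derive_ext_loc (fun s => 0)); [|apply (is_derive_const (V := R_NormedModule))].
      generalize (locally_gt R_UniformSpace _ y m (c2 x y) ltac:(lra)).
      apply filter_imp. intros s hs. symmetry. apply (glue_out h m); assumption.
Qed.

Lemma height_eq x y : x ^ 2 + y ^ 2 < 1 ->
  (1 - (x ^ 2 + y ^ 2)) * invheight x y = sqrt (1 - (x ^ 2 + y ^ 2)).
Proof.
  intros H. unfold invheight.
  assert (hs : 0 < sqrt (1 - (x ^ 2 + y ^ 2))) by (apply sqrt_lt_R0; lra).
  rewrite <- (sqrt_sqrt (1 - (x ^ 2 + y ^ 2))) at 1 by lra. field. lra.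
Qed.

Lemma proj_density_val F x y z : x ^ 2 + y ^ 2 + z ^ 2 = 1 -> 0 < z ->
  proj_density F x y = F x y z / z.
Proof.
  intros H hz. unfold proj_density, glue. destruct (Rlt_dec _ _) as [h|h]; [|nra].
  rewrite height_eq by exact h. unfold invheight.
  replace (1 - (x ^ 2 + y ^ 2)) with (z * z) by lra.
  rewrite sqrt_square by lra. reflexivity.
Qed.

(** A squared radius above 1 - d^2 corresponds to a height below [d], that is to the band around the
    equator where [F] vanishes. *)
Lemma proj_density_near_boundary F d x y :
  0 < d -> (forall x1 x2 x3, on_S2 x1 x2 x3 -> Rabs x3 < d -> F x1 x2 x3 = 0) ->
  1 - d ^ 2 < x ^ 2 + y ^ 2 -> proj_density F x y = 0.
Proof.
  intros hd Hv hm. unfold proj_density, glue. destruct (Rlt_dec _ _) as [h|h]; [|reflexivity].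
  rewrite height_eq by exact h.
  rewrite Hv; [ring| |].
  - unfold on_S2. rewrite pow2_sqrt by lra. ring.
  - rewrite Rabs_right by (apply Rle_ge, sqrt_pos).
    rewrite <- (sqrt_pow2 d) by lra. apply sqrt_lt_1; nra.
Qed.

Lemma proj_density_smooth n F :
  Ck n F ->
  (exists delta, 0 < delta /\
      forall x1 x2 x3, on_S2 x1 x2 x3 -> Rabs x3 < delta -> F x1 x2 x3 = 0) ->
  CkOn n plane (proj_density F).
Proof.
  intros HF [d [hd Hv]].
  apply (CkOn_glue n (fun x y => F x y ((1 - (x ^ 2 + y ^ 2)) * invheight x y) * invheight x y) (1 - d ^ 2)).
  - nra.
  - apply CkOn_mult; [|apply CkOn_invheight].
    apply CkOn_comp; [exact HF|].
    apply CkOn_mult; [|apply CkOn_invheight].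
    unfold Rminus.
    apply (CkOn_plus n disk (fun _ _ => 1) (fun x y => - (x ^ 2 + y ^ 2))); [apply CkOn_const|].
    cut (CkOn n disk (fun x y => (-1) * x * x + (-1) * y * y)).
    { intros H. revert H. apply CkOn_ext. intros; ring. }
    apply CkOn_plus; repeat apply CkOn_mult; auto using CkOn_const, CkOn_fst, CkOn_snd.
  - intros x y hxy hm. assert (E := proj_density_near_boundary F d x y hd Hv hm).
    unfold proj_density in E. rewrite glue_in in E by exact hxy. exact E.
Qed.

(** * Directional derivatives, the Radon transform and the logarithm *)

(** The derivative is taken along (cos phi, sin phi) with the angle argument frozen. Since the
    result depends on [phi] again, keeping [phi] as an argument of the field makes the operation
    iterable. *)
Definition line_derive (H H' : R -> R -> R -> R) : Prop :=
  forall phi x y t,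
    is_derive (fun s => H phi (x + s * cos phi) (y + s * sin phi)) t
              (H' phi (x + t * cos phi) (y + t * sin phi)).

Definition disk_supported (H : R -> R -> R -> R) : Prop :=
  forall phi x y, 1 <= x ^ 2 + y ^ 2 -> H phi x y = 0.

Fixpoint Ck_lines (n : nat) (H : R -> R -> R -> R) : Prop :=
  jcont3 H /\ disk_supported H /\
  match n with
  | O => True
  | S m => exists H', line_derive H H' /\ Ck_lines m H'
  end.

Lemma Ck_lines_plus n H K :
  Ck_lines n H -> Ck_lines n K -> Ck_lines n (fun phi x y => H phi x y + K phi x y).
Proof.
  revert H K. induction n as [|n IH]; intros H K [Hc [Hs Hn]] [Kc [Ks Kn]];
    (split; [intros U f g k x hf hg hk; ct|]);
    (split; [intros phi x y hxy; rewrite Hs, Ks by exact hxy; ring|]); auto.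
  destruct Hn as [H' [Hd Hn]]. destruct Kn as [K' [Kd Kn]].
  exists (fun phi x y => H' phi x y + K' phi x y). split; [|auto].
  intros phi x y t. apply (is_derive_plus (V := R_NormedModule)); [apply Hd|apply Kd].
Qed.

(** A derivative along theta is cos phi times one partial derivative plus sin phi times the other.
    The factor [b] absorbs these weights, so both summands have the form required by the
    induction. *)
Lemma CkOn_lines n h b m :
  m < 1 -> jcont1 b -> CkOn n plane h ->
  (forall x y, m < x ^ 2 + y ^ 2 -> h x y = 0) ->
  Ck_lines n (fun phi x y => b phi * h x y).
Proof.
  intros hm. revert h b. induction n as [|n IH]; intros h b Hb H Hz;
    assert (H0 := CkOn_cont _ _ _ H);
    (split; [intros U f g k x hf hg hk; ct; apply H0; auto; exact I|]);
    (split; [intros phi x y hxy; rewrite Hz by lra; ring|]); auto.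
  destruct H as [_ [h1 [h2 [Hd [H1 H2]]]]].
  assert (c1 : forall x y : R, continuous (fun s : R => s ^ 2 + y ^ 2) x) by (intros; ct).
  assert (c2 : forall x y : R, continuous (fun s : R => x ^ 2 + s ^ 2) y) by (intros; ct).
  assert (Z1 : forall x y, m < x ^ 2 + y ^ 2 -> h1 x y = 0).
  { intros x y hmx. apply (derive_zero_near (fun s => h s y) x); [|apply Hd; exact I].
    generalize (locally_gt _ _ x m (c1 x y) hmx). apply filter_imp. auto. }
  assert (Z2 : forall x y, m < x ^ 2 + y ^ 2 -> h2 x y = 0).
  { intros x y hmx. apply (derive_zero_near (fun s => h x s) y); [|apply Hd; exact I].
    generalize (locally_gt _ _ y m (c2 x y) hmx). apply filter_imp. auto. }
  exists (fun phi x y => (b phi * cos phi) * h1 x y + (b phi * sin phi) * h2 x y).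
  split.
  - intros phi x y t.
    set (X := x + t * cos phi). set (Y := y + t * sin phi).
    replace (b phi * cos phi * h1 X Y + b phi * sin phi * h2 X Y)
      with (b phi * (h1 X Y * cos phi + h2 X Y * sin phi)) by ring.
    apply (is_derive_scal (fun s => h (x + s * cos phi) (y + s * sin phi))).
    apply (is_derive_comp2 h h1 h2).
    + intros; apply Hd; exact I.
    + intros; apply Hd; exact I.
    + intros U f g u hf hg. apply (CkOn_cont _ _ _ H1); auto. exact I.
    + auto_derive; [auto|ring].
    + auto_derive; [auto|ring].
  - apply Ck_lines_plus; apply IH; auto; intros p; ct.
Qed.

Lemma proj_density_lines n F :
  Ck n F ->
  (exists delta, 0 < delta /\
      forall x1 x2 x3, on_S2 x1 x2 x3 -> Rabs x3 < delta -> F x1 x2 x3 = 0) ->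
  Ck_lines n (fun _ x y => proj_density F x y).
Proof.
  intros HF Hv. assert (Hs := proj_density_smooth n F HF Hv).
  replace (fun _ x y : R => proj_density F x y)
    with (fun phi x y : R => (fun _ => 1) phi * proj_density F x y).
  - destruct Hv as [d [hd Hv]].
    apply CkOn_lines with (1 - d ^ 2); auto.
    + nra.
    + intros x. ct.
    + intros x y hxy. apply (proj_density_near_boundary F d); assumption.
  - apply functional_extensionality; intros phi. apply functional_extensionality; intros x.
    apply functional_extensionality; intros y. apply Rmult_1_l.
Qed.

(** The line is t theta + s theta_perp. Its chord in the unit disk lies in |s| <= 1, so for a
    disk-supported field the bounded window loses nothing. Varying [t] moves the points along theta,
    which matches [line_derive]. *)
Definition radon (H : R -> R -> R -> R) (phi t : R) : R :=
  RInt (fun s => H phi (- s * sin phi + t * cos phi) (s * cos phi + t * sin phi)) (-2) 2.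

Lemma radon_jcont H : jcont3 H -> jcont2 (radon H).
Proof.
  intros Hc.
  apply (jcont2_RInt (fun phi t s =>
           H phi (- s * sin phi + t * cos phi) (s * cos phi + t * sin phi))).
  intros U f g k x hf hg hk. ct.
Qed.

Lemma trig_norm phi s t :
  (- s * sin phi + t * cos phi) ^ 2 + (s * cos phi + t * sin phi) ^ 2 = s ^ 2 + t ^ 2.
Proof.
  assert (E := sin2_cos2 phi). unfold Rsqr in E.
  transitivity ((s ^ 2 + t ^ 2) * (sin phi * sin phi + cos phi * cos phi)); [ring|].
  rewrite E. ring.
Qed.

Lemma Rabs_ge1_sq t : 1 <= Rabs t -> 1 <= t ^ 2.
Proof. intros h. rewrite <- pow2_abs. nra. Qed.

Lemma radon_support H phi t : disk_supported H -> 1 <= Rabs t -> radon H phi t = 0.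
Proof.
  intros Hs ht. unfold radon. apply RIntR_zero; [lra|]. intros s _.
  apply Hs. rewrite trig_norm. apply Rabs_ge1_sq in ht. nra.
Qed.

Lemma radon_derive H H' phi t :
  jcont3 H -> jcont3 H' -> line_derive H H' ->
  is_derive (radon H phi) t (radon H' phi t).
Proof.
  intros Hc Hc' Hd.
  apply (is_derive_RInt_jcont
           (fun t s => H phi (- s * sin phi + t * cos phi) (s * cos phi + t * sin phi))
           (fun t s => H' phi (- s * sin phi + t * cos phi) (s * cos phi + t * sin phi))).
  - intros y s. apply Hd.
  - intros U f g x hf hg. ct.
  - intros U f g x hf hg. ct.
Qed.

(* An antiderivative of [ln |u|] off [0]; as [ln] is total, it vanishes at [0]. *)
Definition elog (u : R) : R := u * ln (Rabs u) - u.

Lemma ln_Rabs_derive u : u <> 0 -> is_derive (fun x => ln (Rabs x)) u (/ u).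
Proof.
  intros hu. destruct (Rdichotomy _ _ hu) as [h|h].
  - apply (is_derive_ext_loc (fun x => ln (- x))).
    + apply (locally_intro u (- u)); [lra|]. intros y hy. apply Rabs_def2 in hy.
      rewrite Rabs_left by lra. reflexivity.
    + auto_derive; [lra|]. field. lra.
  - apply (is_derive_ext_loc ln).
    + apply (locally_intro u u); [lra|]. intros y hy. apply Rabs_def2 in hy.
      rewrite Rabs_right by lra. reflexivity.
    + apply is_derive_Reals, derivable_pt_lim_ln, h.
Qed.

Lemma elog_derive u : u <> 0 -> is_derive elog u (ln (Rabs u)).
Proof.
  intros hu. unfold elog.
  replace (ln (Rabs u)) with ((1 * ln (Rabs u) + u * / u) - 1) by (field; exact hu).
  apply (is_derive_minus (V := R_NormedModule)).
  - apply (is_derive_multR (fun x => x) (fun x => ln (Rabs x))).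
    + apply (is_derive_id (K := R_AbsRing)).
    + apply ln_Rabs_derive, hu.
  - apply (is_derive_id (K := R_AbsRing)).
Qed.

Lemma elog_0 : elog 0 = 0.
Proof. unfold elog. ring. Qed.

(** With w = sqrt x one has x ln x = 2 w^2 ln w, and - ln w <= 1 / w - 1 by the inequality exp z >=
    1 + z. *)
Lemma mul_ln_bound x : 0 < x < 1 -> Rabs (x * ln x) <= 2 * sqrt x.
Proof.
  intros hx.
  assert (hs : 0 < sqrt x) by (apply sqrt_lt_R0; lra).
  assert (E : sqrt x * sqrt x = x) by (apply sqrt_sqrt; lra).
  assert (hl : ln x < 0) by (rewrite <- ln_1; apply ln_increasing; lra).
  assert (B : - ln (sqrt x) <= / sqrt x - 1).
  { rewrite <- ln_Rinv by exact hs.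
    assert (K := exp_ineq1_le (ln (/ sqrt x))).
    rewrite exp_ln in K by (apply Rinv_0_lt_compat, hs). lra. }
  assert (C : ln x = 2 * ln (sqrt x)).
  { rewrite <- E at 1. rewrite ln_mult by exact hs. ring. }
  rewrite Rabs_left by nra.
  assert (D : sqrt x * / sqrt x = 1) by (field; lra).
  replace (- (x * ln x)) with (2 * (sqrt x * (sqrt x * (- ln (sqrt x))))) by (rewrite C, <- E; rewrite E; ring [E]).
  nra.
Qed.

Lemma elog_cont : jcont1 elog.
Proof.
  intros u. destruct (Req_dec u 0) as [h|h].
  2: { eapply is_derive_cont, elog_derive, h. }
  subst u. apply continuous_R_spec. intros e he.
  (* The bound [(e / 4) ^ 2] makes 2 sqrt |y| < e / 2 for the logarithmic term, [e / 2] handles the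
     linear term, and 1 is the range of [mul_ln_bound]. *)
  apply (locally_intro 0 (Rmin 1 (Rmin (e / 2) ((e / 4) ^ 2)))).
  { repeat apply Rmin_pos; try lra. nra. }
  intros y hy. rewrite elog_0.
  assert (h1 := Rmin_l 1 (Rmin (e / 2) ((e / 4) ^ 2))).
  assert (h2 := Rmin_r 1 (Rmin (e / 2) ((e / 4) ^ 2))).
  assert (h3 := Rmin_l (e / 2) ((e / 4) ^ 2)).
  assert (h4 := Rmin_r (e / 2) ((e / 4) ^ 2)).
  rewrite Rminus_0_r in *.
  destruct (Req_dec y 0) as [h0|h0].
  { subst y. rewrite elog_0, Rabs_R0. exact he. }
  assert (hp := Rabs_pos_lt y h0).
  assert (B := mul_ln_bound (Rabs y) ltac:(lra)).
  assert (S : sqrt (Rabs y) < e / 4).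
  { rewrite <- (sqrt_pow2 (e / 4)) by lra. apply sqrt_lt_1; [lra|nra|lra]. }
  unfold elog. eapply Rle_lt_trans; [apply Rabs_triang|].
  rewrite Rabs_Ropp, Rabs_mult in *. rewrite Rabs_Rabsolu in B. lra.
Qed.

Lemma Rint_antiderivative (g f F : R -> R) (a b : R) :
  a <= b ->
  (forall x, a <= x <= b -> is_derive F x (f x)) ->
  (forall x, a <= x <= b -> continuous f x) ->
  (forall x, a <= x <= b -> g x = f x) ->
  Rint g a b = F b - F a.
Proof.
  intros hab Hd Hc E.
  assert (I : is_RInt f a b (F b - F a)).
  { apply (is_RInt_derive (V := R_CompleteNormedModule) F f);
      rewrite Rmin_left, Rmax_right by lra; assumption. }
  assert (I' : is_RInt g a b (F b - F a)).
  { apply (is_RInt_ext (V := R_NormedModule) f); [|exact I].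
    rewrite Rmin_left, Rmax_right by lra. intros x hx. symmetry. apply E. lra. }
  rewrite Rint_RInt by (eexists; exact I').
  apply (is_RInt_unique (V := R_CompleteNormedModule)), I'.
Qed.

(* Integration by parts against [ln |t - a|] on either side of the singularity. *)
Lemma log_integral (g r r' : R -> R) (a : R) :
  -1 < a < 1 -> jcont1 r' ->
  (forall t, is_derive r t (r' t)) ->
  (forall t, 1 <= Rabs t -> r t = 0) ->
  (forall t, 1 <= Rabs t -> r' t = 0) ->
  (forall t, g t = r t * ln (Rabs (t - a))) ->
  lim0plus (fun eps => Rint g (-1) (a - eps) + Rint g (a + eps) 1)
  = - RInt (fun u => r' (a + u) * elog u) (-2) 2.
Proof.
  intros ha Hc Hd Hz Hz' Hg.
  assert (Hr : jcont1 r) by (intros t; eapply is_derive_cont, Hd).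
  assert (He := elog_cont).
  set (k := fun t => r' t * elog (t - a)).
  assert (Hk : jcont1 k) by (intros t; unfold k; ct).
  (* Closed form of the truncated integral after integration by parts; the boundary terms at -1 and
     1 are already dropped because [r] vanishes there. It is continuous at 0, and the remaining
     boundary terms vanish at 0 because [elog 0 = 0]. *)
  set (S := fun eps => (r (a - eps) * elog (- eps) - r (a + eps) * elog eps)
              - (RInt k (-1) (a - eps) + (RInt k (-1) 1 - RInt k (-1) (a + eps)))).
  transitivity (S 0).
  - apply (lim0plus_continuous _ S (Rmin (1 - a) (1 + a))).
    + apply Rmin_pos; lra.
    + assert (HI : jcont1 (fun x => RInt k (-1) x)).
      { intros x. eapply is_derive_cont, is_derive_RInt_bound, Hk. }
      unfold S. ct; apply (cont_comp1 _ (fun x => RInt k (-1) x)); try apply HI; ct.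
    + intros e he.
      assert (h1 := Rmin_l (1 - a) (1 + a)). assert (h2 := Rmin_r (1 - a) (1 + a)).
      set (P := fun t => r t * elog (t - a) - RInt k (-1) t).
      assert (HP : forall t, t <> a -> is_derive P t (r t * ln (Rabs (t - a)))).
      { intros t ht. unfold P.
        replace (r t * ln (Rabs (t - a)))
          with ((r' t * elog (t - a) + r t * (ln (Rabs (t - a)) * 1)) - k t) by (unfold k; ring).
        apply (is_derive_minus (V := R_NormedModule)); [|apply is_derive_RInt_bound, Hk].
        apply (is_derive_multR r (fun t => elog (t - a))); [apply Hd|].
        rewrite Rmult_comm.
        apply (is_derive_comp (V := R_NormedModule) elog (fun t => t - a)).
        - apply elog_derive. lra.
        - auto_derive; [auto|ring]. }
      assert (HC : forall t, t <> a -> continuous (fun t => r t * ln (Rabs (t - a))) t).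
      { intros t ht. ct. apply (cont_comp1 _ (fun x => ln (Rabs x)) (fun t => t - a)); [ct|].
        eapply is_derive_cont, ln_Rabs_derive. lra. }
      rewrite (Rint_antiderivative g (fun t => r t * ln (Rabs (t - a))) P (-1) (a - e)),
              (Rint_antiderivative g (fun t => r t * ln (Rabs (t - a))) P (a + e) 1);
        try lra; try (intros; apply Hg); try (intros; first [apply HP|apply HC]; lra).
      unfold P, S.
      rewrite (Hz (-1)) by (rewrite Rabs_left; lra). rewrite (Hz 1) by (rewrite Rabs_right; lra).
      replace (a - e - a) with (- e) by ring. replace (a + e - a) with e by ring.
      rewrite RIntR_point. ring.
  - unfold S. rewrite Ropp_0, elog_0, Rminus_0_r, Rplus_0_r.
    transitivity (- RInt k (-1) 1); [ring|]. f_equal.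
    transitivity (RInt k (-2) 2).
    + symmetry. apply RIntR_support; auto; try lra. intros x hx. unfold k. rewrite Hz'; [ring|].
      destruct hx; [rewrite Rabs_left|rewrite Rabs_right]; lra.
    + rewrite <- (RIntR_shift_support k a); auto; try lra.
      * apply RIntR_ext_all. intros u. unfold k. f_equal; f_equal; ring.
      * intros x hx. unfold k. rewrite Hz' by exact hx. ring.
Qed.

(** * From the slice transform to the Radon transform *)

(** On the upper arc substitute s = r cos psi. Since x_3 = r sin psi, the arc element r dpsi
    becomes, up to orientation, r ds / x_3, and F / x_3 is the density. The lower arc contributes
    the same by evenness under psi -> 2 pi - psi. *)
Lemma Vf_radon F H phi t :
  jcont3 F ->
  (forall x1 x2 x3, on_S2 x1 x2 x3 -> F x1 x2 (- x3) = F x1 x2 x3) ->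
  (forall x1 x2, on_S2 x1 x2 0 -> F x1 x2 0 = 0) ->
  jcont3 H -> disk_supported H ->
  (forall phi x y, H phi x y = proj_density F x y) ->
  Vf F phi t = 2 * sqrt (1 - t ^ 2) * radon H phi t.
Proof.
  intros HF He H0 Hc Hs Hh.
  unfold Vf. set (r := sqrt (1 - t ^ 2)).
  destruct (Rlt_dec (t ^ 2) 1) as [ht|ht].
  (* For |t| >= 1 the total [sqrt] returns 0, so both sides vanish. *)
  2: { assert (E : r = 0) by (apply sqrt_neg_0; lra).
       rewrite E. rewrite (Rint_RInt_ext _ (fun _ => 0)).
       - rewrite RIntR_const. ring.
       - assert (A := PI_RGT_0). lra.
       - intros x. ct.
       - intros. ring. }
  assert (hr : 0 < r) by (apply sqrt_lt_R0; lra).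
  assert (hr2 : r * r = 1 - t ^ 2) by (apply sqrt_sqrt; lra).
  set (P := fun psi => F (t * cos phi - r * cos psi * sin phi) (t * sin phi + r * cos psi * cos phi)
                     (r * sin psi) * r).
  assert (HP : jcont1 P) by (intros x; unfold P; ct).
  assert (Hon : forall psi, on_S2 (t * cos phi - r * cos psi * sin phi)
                  (t * sin phi + r * cos psi * cos phi) (r * sin psi)).
  { intros psi. unfold on_S2.
    assert (E := trig_norm phi (r * cos psi) t). assert (E2 := sin2_cos2 psi). unfold Rsqr in E2.
    replace (t * cos phi - r * cos psi * sin phi) with (- (r * cos psi) * sin phi + t * cos phi) by ring.
    replace (t * sin phi + r * cos psi * cos phi) with ((r * cos psi) * cos phi + t * sin phi) by ring.
    rewrite E.
    transitivity (r * r * (sin psi * sin psi + cos psi * cos psi) + t ^ 2); [ring|].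
    rewrite E2, hr2. ring. }
  assert (hpi := PI_RGT_0).
  rewrite (Rint_RInt_ext _ P) by (auto; lra).
  set (q := fun s => H phi (- s * sin phi + t * cos phi) (s * cos phi + t * sin phi)).
  assert (Hq : jcont1 q) by (intros x; unfold q; ct).
  assert (Half : RInt P 0 PI = r * radon H phi t :> R).
  { rewrite (RIntR_ext P (fun psi => (- r) * ((- r * sin psi) * q (r * cos psi)))); [| |lra].
    - rewrite RIntR_scal by (intros x; ct).
      assert (E := RInt_comp (V := R_CompleteNormedModule) q (fun psi => r * cos psi)
                (fun psi => - r * sin psi) 0 PI).
      unfold scal in E; simpl in E; unfold mult in E; simpl in E. rewrite E.
      + rewrite cos_0, cos_PI.
        replace (r * -1) with (- r) by ring. rewrite Rmult_1_r.
        assert (E2 := RIntR_Chasles q r (- r) r Hq). rewrite RIntR_point in E2.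
        assert (E3 : radon H phi t = RInt q (- r) r :> R).
        (* Beyond the chord of half-length [r] the line has left the disk, so the Radon integral
           reduces to [-r, r]. *)
        { assert (r <= 1) by nra.
          apply RIntR_support; auto; try lra. intros s hs.
          apply Hs. rewrite trig_norm.
          assert (r * r <= s ^ 2) by (destruct hs; nra). lra. }
        rewrite E3.
        assert (E4 : RInt q r (- r) = - RInt q (- r) r :> R) by lra.
        rewrite E4. match goal with |- @eq _ ?a ?b => change (@eq R a b) end. ring.
      + intros x _. apply Hq.
      + intros x _. split; [auto_derive; [auto|ring]|ct].
    - intros psi hpsi. unfold P, q. rewrite Hh.
      replace (- (r * cos psi) * sin phi + t * cos phi) with (t * cos phi - r * cos psi * sin phi) by ring.
      replace (r * cos psi * cos phi + t * sin phi) with (t * sin phi + r * cos psi * cos phi) by ring.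
      specialize (Hon psi).
      (* At the ends of the arc the quotient F / x_3 is undefined; there the point lies on the
         equator and [F] is zero. *)
      destruct (Req_dec (sin psi) 0) as [hz|hz].
      + rewrite hz, Rmult_0_r in Hon. rewrite hz, Rmult_0_r, H0 by exact Hon. ring.
      + assert (hsin : 0 < r * sin psi).
        { apply Rmult_lt_0_compat; [exact hr|].
          assert (0 <= sin psi) by (apply sin_ge_0; lra). lra. }
        rewrite (proj_density_val F _ _ _ Hon hsin). field. split; lra. }
  rewrite <- (RIntR_Chasles P 0 PI (2 * PI) HP).
  assert (E := RIntR_flip P (2 * PI) 0 PI HP).
  rewrite Rminus_0_r in E. replace (2 * PI - PI) with PI in E by ring.
  rewrite <- E.
  rewrite (RIntR_ext_all (fun y => P (2 * PI - y)) P).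
  - rewrite Half. ring.
  - intros psi. unfold P.
    assert (Ec : cos (2 * PI - psi) = cos psi).
    { rewrite <- cos_neg. replace (- (2 * PI - psi)) with (psi + 2 * INR 1 * - PI) by (simpl; ring).
      replace (psi + 2 * INR 1 * - PI) with (psi - 2 * PI) by (simpl; ring).
      rewrite <- (cos_period (psi - 2 * PI) 1). f_equal. simpl. ring. }
    assert (Es : sin (2 * PI - psi) = - sin psi).
    { rewrite <- sin_neg. rewrite <- (sin_period (- psi) 1). f_equal. simpl. ring. }
    rewrite Ec, Es. replace (r * - sin psi) with (- (r * sin psi)) by ring.
    rewrite He by apply Hon. reflexivity.
Qed.

Lemma trig_proj_sq phi y1 y2 :
  (cos phi * y1 + sin phi * y2) ^ 2 + (- sin phi * y1 + cos phi * y2) ^ 2 = y1 ^ 2 + y2 ^ 2.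
Proof.
  assert (E := sin2_cos2 phi). unfold Rsqr in E.
  transitivity ((y1 ^ 2 + y2 ^ 2) * (sin phi * sin phi + cos phi * cos phi)); [ring|].
  rewrite E. ring.
Qed.

Lemma trig_proj_bound phi y1 y2 :
  y1 ^ 2 + y2 ^ 2 < 1 -> -1 < cos phi * y1 + sin phi * y2 < 1.
Proof.
  intros h. assert (E := trig_proj_sq phi y1 y2).
  set (a := cos phi * y1 + sin phi * y2) in *. set (b := - sin phi * y1 + cos phi * y2) in *.
  assert (a ^ 2 < 1) by nra. nra.
Qed.

Lemma inner_int_radon F H H' phi y1 y2 :
  (forall t, Vf F phi t = 2 * sqrt (1 - t ^ 2) * radon H phi t) ->
  jcont3 H -> jcont3 H' -> disk_supported H -> disk_supported H' -> line_derive H H' ->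
  y1 ^ 2 + y2 ^ 2 < 1 ->
  inner_int F phi y1 y2
  = -2 * RInt (fun u => radon H' phi (cos phi * y1 + sin phi * y2 + u) * elog u) (-2) 2.
Proof.
  intros HV Hc Hc' Hs Hs' Hd hy. unfold inner_int.
  assert (Hr := radon_jcont H' Hc'). assert (He := elog_cont).
  rewrite (log_integral _ (fun t => 2 * radon H phi t) (fun t => 2 * radon H' phi t)).
  - rewrite (RIntR_ext_all _ (fun u => 2 *
       (radon H' phi (cos phi * y1 + sin phi * y2 + u) * elog u))) by (intros; ring).
    rewrite RIntR_scal by (intros u; ct). ring.
  - apply trig_proj_bound, hy.
  - intros z. ct.
  - intros t. apply (is_derive_scal (radon H phi)). apply radon_derive; assumption.
  - intros t ht. rewrite radon_support by assumption. ring.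
  - intros t ht. rewrite radon_support by assumption. ring.
  - intros t. rewrite HV.
    destruct (Rlt_dec (t ^ 2) 1) as [h|h].
    + assert (0 < sqrt (1 - t ^ 2)) by (apply sqrt_lt_R0; lra). field. lra.
    (* For |t| >= 1 the denominator is 0 and cannot be cancelled, but the Radon transform vanishes
       and makes both sides 0. *)
    + rewrite radon_support; [unfold Rdiv; ring|exact Hs|].
      rewrite <- pow2_abs in h. assert (hp := Rabs_pos t). nra.
Qed.

(** The integration variable is u = t - theta.y, so [y] enters only through [K]. The weight [b]
    collects the factors cos phi and sin phi produced by derivatives in [y], which makes this family
    closed under differentiation. *)
Definition log_backproj (b : R -> R) (K : R -> R -> R) (y1 y2 : R) : R :=
  RInt (fun phi => b phi * RInt (fun u => K phi (cos phi * y1 + sin phi * y2 + u) * elog u) (-2) 2)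
    0 (2 * PI).

Lemma log_backproj_inner_jcont K y1 y2 : jcont2 K ->
  jcont1 (fun phi => RInt (fun u => K phi (cos phi * y1 + sin phi * y2 + u) * elog u) (-2) 2).
Proof.
  intros HK. assert (He := elog_cont).
  apply (jcont1_RInt (fun phi u => K phi (cos phi * y1 + sin phi * y2 + u) * elog u)).
  intros U f g x hf hg. ct.
Qed.

(** Differentiation along a curve (p, q) treats both partial derivatives at once; [v phi] is the
    speed of theta.y. The singular kernel enters only as the continuous factor [elog u], which is
    constant in [s]. *)
Lemma log_backproj_derive b K K' (p q v : R -> R) (s : R) :
  jcont1 b -> jcont2 K -> jcont2 K' ->
  (forall phi t, is_derive (K phi) t (K' phi t)) ->
  jcont1 p -> jcont1 q -> jcont1 v ->
  (forall phi s, is_derive (fun s => cos phi * p s + sin phi * q s) s (v phi)) ->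
  is_derive (fun s => log_backproj b K (p s) (q s)) s
            (log_backproj (fun phi => b phi * v phi) K' (p s) (q s)).
Proof.
  intros Hb HK HK' Hd Hy1 Hy2 Hv Hy. assert (He := elog_cont).
  assert (J : forall K, jcont2 K -> jcont3 (fun s phi u =>
             K phi (cos phi * p s + sin phi * q s + u) * elog u)).
  { intros K0 HK0 U f g k x hf hg hk. ct. }
  assert (J2 : forall K, jcont2 K -> jcont2 (fun s phi =>
             RInt (fun u => K phi (cos phi * p s + sin phi * q s + u) * elog u) (-2) 2)).
  { intros K0 HK0. apply (jcont2_RInt _ (-2) 2 (J K0 HK0)). }
  unfold log_backproj.
  apply (is_derive_RInt_jcont
    (fun s phi => b phi * RInt (fun u => K phi (cos phi * p s + sin phi * q s + u) * elog u) (-2) 2)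
    (fun s phi => b phi * v phi *
       RInt (fun u => K' phi (cos phi * p s + sin phi * q s + u) * elog u) (-2) 2)).
  - intros s0 phi. rewrite Rmult_assoc.
    apply (is_derive_scal (fun s => RInt (fun u => K phi (cos phi * p s + sin phi * q s + u) * elog u) (-2) 2)).
    rewrite <- RIntR_scal by (intros u; ct).
    apply (is_derive_RInt_jcont
      (fun s u => K phi (cos phi * p s + sin phi * q s + u) * elog u)
      (fun s u => v phi * (K' phi (cos phi * p s + sin phi * q s + u) * elog u))).
    + intros s1 u.
      rewrite <- Rmult_assoc.
      rewrite (Rmult_comm (v phi * _)).
      apply (is_derive_ext (fun s => elog u * K phi (cos phi * p s + sin phi * q s + u)));
        [intros; apply Rmult_comm|].
      apply (is_derive_scal (fun s => K phi (cos phi * p s + sin phi * q s + u))).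
      apply (is_derive_comp (V := R_NormedModule) (K phi) (fun s => cos phi * p s + sin phi * q s + u));
        [apply Hd|].
      replace (v phi) with (v phi + 0) by ring.
      apply (is_derive_plus (V := R_NormedModule)); [apply Hy|apply (is_derive_const (V := R_NormedModule))].
    + intros U f g x hf hg. apply (J K HK U f (fun _ => phi) g x); ct.
    + intros U f g x hf hg. apply cont_mult; [ct|]. apply (J K' HK' U f (fun _ => phi) g x); ct.
  - intros U f g x hf hg. apply cont_mult; [ct|]. apply (J2 K HK U f g x); ct.
  - intros U f g x hf hg. apply cont_mult; [ct|]. apply (J2 K' HK' U f g x); ct.
Qed.

(** * Radial averages *)

(* [Q1 u = u * kappa u], so two integrations by parts turn the pairing of [Q1'']
   with [elog] into the integral of [Q1 u / u = kappa u]. *)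
Lemma elog_pairing (Q1 Q2 Q3 kappa : R -> R) (L : R) :
  0 < L ->
  (forall u, is_derive Q1 u (Q2 u)) -> (forall u, is_derive Q2 u (Q3 u)) ->
  jcont1 Q3 -> jcont1 kappa ->
  (forall u, u <> 0 -> Q1 u = u * kappa u) ->
  Q2 L = 0 -> Q2 (- L) = 0 -> kappa L = 0 -> kappa (- L) = 0 ->
  RInt (fun u => Q3 u * elog u) (- L) L = RInt kappa (- L) L :> R.
Proof.
  intros hL D1 D2 C3 Ck HQ z1 z2 z3 z4.
  assert (C2 : jcont1 Q2) by (intros u; eapply is_derive_cont, D2).
  assert (He := elog_cont).
  assert (HI : jcont1 (fun x => RInt kappa 0 x)).
  { intros x. eapply is_derive_cont, is_derive_RInt_bound, Ck. }
  (* Off 0 the middle term equals Q1 u * ln |u|, because u ln |u| = elog u + u. Written with [kappa]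
     it is continuous at 0, so the two half intervals join there without a boundary term. *)
  set (Phi := fun u => Q2 u * elog u - kappa u * (elog u + u) + RInt kappa 0 u).
  assert (HPc : jcont1 Phi) by (intros u; unfold Phi; ct).
  assert (HPd : forall u, u <> 0 -> is_derive Phi u (Q3 u * elog u)).
  { intros u hu.
    apply (is_derive_ext_loc (fun u => Q2 u * elog u - Q1 u * ln (Rabs u) + RInt kappa 0 u)).
    - apply (locally_intro u (Rabs u)); [apply Rabs_pos_lt, hu|]. intros y hy.
      assert (hy0 : y <> 0).
      { intros ->. rewrite Rminus_0_l, Rabs_Ropp in hy. lra. }
      unfold Phi. rewrite HQ by exact hy0. unfold elog. eqR. ring.
    - replace (Q3 u * elog u)
        with ((Q3 u * elog u + Q2 u * ln (Rabs u)) - (Q2 u * ln (Rabs u) + Q1 u * / u) + kappa u)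
        by (rewrite HQ by exact hu; field; exact hu).
      apply (is_derive_plus (V := R_NormedModule)); [|apply is_derive_RInt_bound, Ck].
      apply (is_derive_minus (V := R_NormedModule)).
      + apply (is_derive_multR Q2 elog); [apply D2|apply elog_derive, hu].
      + apply (is_derive_multR Q1 (fun u => ln (Rabs u))); [apply D1|apply ln_Rabs_derive, hu]. }
  assert (Cg : jcont1 (fun u => Q3 u * elog u)) by (intros u; ct).
  rewrite <- (RIntR_Chasles _ (- L) 0 L Cg).
  rewrite (RInt_newton Phi _ (- L) 0), (RInt_newton Phi _ 0 L); auto; try lra;
    try (intros; apply HPd; lra); try (intros; apply HPc).
  unfold Phi. rewrite z1, z2, z3, z4.
  assert (E := RIntR_Chasles kappa 0 (- L) L Ck). rewrite RIntR_point. lra.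
Qed.

(* Replaces polar coordinates: both sides have the same
   derivative in [L]. *)
Lemma radial_square_integral (k m m' : R -> R) (L : R) :
  0 < L -> jcont1 k -> jcont1 m' ->
  (forall x, is_derive m x (m' x)) ->
  (forall x, 0 <= x -> m' x = x * k x) ->
  RInt (fun u => RInt (fun s => k (sqrt (u ^ 2 + s ^ 2))) 0 L) 0 L
  = 2 * RInt (fun v => (m (L * sqrt (1 + v ^ 2)) - m 0) / (1 + v ^ 2)) 0 1 :> R.
Proof.
  intros hL Ck Cm' Dm Hm'.
  assert (Cm : jcont1 m) by (intros x; eapply is_derive_cont, Dm).
  assert (H1v : forall v, 0 < 1 + v ^ 2) by (intros v; assert (h := pow2_ge_0 v); lra).
  set (f := fun u s => k (sqrt (u ^ 2 + s ^ 2))).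
  assert (Cf : jcont2 f) by (intros U p q x hp hq; unfold f; ct).
  assert (Cf' : jcont2 (fun y x => f x y)) by (intros U p q x hp hq; unfold f; ct).
  (* Derivative of a rectangle integral in one side. The integral over the moving edge is rescaled
     to [0,1] so that its joint continuity in both sides follows from fixed limits. *)
  assert (HB : forall g, jcont2 g -> forall y x, is_derive (fun z => RInt (fun u => RInt (g u) 0 y) 0 z) x
                    (y * RInt (fun t => g x (y * t)) 0 1)).
  { intros g Cg y x.
    replace (y * RInt (fun t => g x (y * t)) 0 1) with (RInt (g x) 0 y).
    - apply (is_derive_RInt_bound (fun u => RInt (g u) 0 y)). apply jcont1_RInt, Cg.
    - rewrite <- RIntR_scal by (intros t; ct).
      rewrite (RIntR_ext_all (fun t => y * g x (y * t)) (fun t => y * g x (y * t + 0)))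
        by (intros; rewrite Rplus_0_r; reflexivity).
      rewrite RIntR_comp_lin by (intros t; ct).
      rewrite Rmult_0_r, Rplus_0_r, Rmult_1_r, Rplus_0_r. reflexivity. }
  (* The square is the diagonal case of the rectangle; Fubini exchanges the roles of the sides, and
     the symmetry of [f] makes the two edges contribute equally. *)
  assert (HJ : forall z, is_derive (fun z => RInt (fun u => RInt (f u) 0 z) 0 z) z
                 (2 * (z * RInt (fun t => f z (z * t)) 0 1))).
  { intros z.
    replace (2 * (z * RInt (fun t => f z (z * t)) 0 1))
      with (z * RInt (fun t => f z (z * t)) 0 1 * 1 + z * RInt (fun t => f (z * t) z) 0 1 * 1).
    - apply (is_derive_comp2 (fun x y => RInt (fun u => RInt (f u) 0 y) 0 x)
               (fun x y => y * RInt (fun t => f x (y * t)) 0 1)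
               (fun x y => x * RInt (fun t => f (x * t) y) 0 1) (fun s => s) (fun s => s)).
      + intros x y. apply (HB f Cf y x).
      + intros x y.
        apply (is_derive_ext (fun y => RInt (fun s => RInt (fun u => f u s) 0 x) 0 y)).
        * intros w. symmetry. apply (RInt_Fubini f). exact Cf.
        * apply (HB (fun s u => f u s) Cf' x y).
      + intros U p q x hp hq. apply cont_mult; [exact hq|].
        apply (jcont2_RInt (fun x y t => f x (y * t))); auto.
        intros U' p' q' r' x' hp' hq' hr'. ct.
      + apply (is_derive_id (K := R_AbsRing)).
      + apply (is_derive_id (K := R_AbsRing)).
    - rewrite (RIntR_ext_all (fun t => f (z * t) z) (fun t => f z (z * t)));
        [eqR; ring|].
      intros t. unfold f. do 2 f_equal. ring. }
  (* Here [v] is the tangent of the polar angle in half of the square, z sqrt (1 + v^2) is the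
     distance at which the ray leaves it, and dv / (1 + v^2) is the angular element. With w = sqrt
     (1 + v^2), the relation m' (rho) = rho k (rho) turns m' (z w) w / w^2 into z k (z w), the edge
     integrand. *)
  assert (HN : forall z, 0 <= z ->
    is_derive (fun z => 2 * RInt (fun v => (m (z * sqrt (1 + v ^ 2)) - m 0) / (1 + v ^ 2)) 0 1) z
                 (2 * (z * RInt (fun t => f z (z * t)) 0 1))).
  { intros z hz. apply (is_derive_scal (fun z => RInt (fun v => (m (z * sqrt (1 + v ^ 2)) - m 0) / (1 + v ^ 2)) 0 1)).
    replace (z * RInt (fun t => f z (z * t)) 0 1)
      with (RInt (fun v => m' (z * sqrt (1 + v ^ 2)) * sqrt (1 + v ^ 2) / (1 + v ^ 2)) 0 1).
    - apply (is_derive_RInt_jcont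
        (fun z v => (m (z * sqrt (1 + v ^ 2)) - m 0) / (1 + v ^ 2))
        (fun z v => m' (z * sqrt (1 + v ^ 2)) * sqrt (1 + v ^ 2) / (1 + v ^ 2))).
      + intros y v.
        unfold Rdiv.
        apply (is_derive_ext (fun z => / (1 + v ^ 2) * (m (z * sqrt (1 + v ^ 2)) - m 0)));
          [intros; apply Rmult_comm|].
        rewrite (Rmult_comm _ (/ (1 + v ^ 2))).
        apply (is_derive_scal (fun z => m (z * sqrt (1 + v ^ 2)) - m 0)).
        replace (m' (y * sqrt (1 + v ^ 2)) * sqrt (1 + v ^ 2))
          with (sqrt (1 + v ^ 2) * m' (y * sqrt (1 + v ^ 2)) - 0) by ring.
        apply (is_derive_minus (V := R_NormedModule)); [|apply (is_derive_const (V := R_NormedModule))].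
        apply (is_derive_comp (V := R_NormedModule) m (fun z => z * sqrt (1 + v ^ 2))); [apply Dm|].
        auto_derive; [auto|simpl; ring].
      + intros U p q x hp hq. ct. apply Rgt_not_eq, H1v.
      + intros U p q x hp hq. ct. apply Rgt_not_eq, H1v.
    - rewrite <- RIntR_scal by (intros t; ct).
      apply RIntR_ext_all. intros v.
      assert (hs : 0 < sqrt (1 + v ^ 2)) by (apply sqrt_lt_R0, H1v).
      rewrite Hm' by nra. unfold f.
      replace (z ^ 2 + (z * v) ^ 2) with (z ^ 2 * (1 + v ^ 2)) by ring.
      rewrite sqrt_mult_alt by apply pow2_ge_0. rewrite sqrt_pow2 by exact hz.
      assert (hw := sqrt_sqrt (1 + v ^ 2) ltac:(left; apply H1v)).
      set (w := sqrt (1 + v ^ 2)) in *. clearbody w. rewrite <- hw. field. lra. }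
  assert (E := zero_derive_const (fun z => RInt (fun u => RInt (f u) 0 z) 0 z
      - 2 * RInt (fun v => (m (z * sqrt (1 + v ^ 2)) - m 0) / (1 + v ^ 2)) 0 1) 0 L hL).
  cbv beta in E. rewrite RIntR_point in E.
  rewrite (RIntR_zero (fun v => (m (0 * sqrt (1 + v ^ 2)) - m 0) / (1 + v ^ 2)) 0 1) in E.
  2: lra.
  2: { intros v _. rewrite Rmult_0_l. unfold Rdiv. ring. }
  apply Rminus_diag_uniq. symmetry. rewrite Rmult_0_r, Rminus_0_r in E. apply E.
  - intros z hz.
    eapply is_derive_minus_same; [apply HJ|apply HN; lra].
  - intros z hz. apply cont_minus; eapply is_derive_cont; [apply HJ|apply HN; lra].
Qed.

(** * Sums over circles and over lines at a given distance from a point *)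

Definition circle_sum (H : R -> R -> R -> R) (y1 y2 rho : R) : R :=
  RInt (fun phi => H phi (y1 + rho * cos phi) (y2 + rho * sin phi)) 0 (2 * PI).

Lemma circle_sum_cont H y1 y2 : jcont3 H -> jcont1 (circle_sum H y1 y2).
Proof.
  intros Hc.
  apply (jcont1_RInt (fun rho phi => H phi (y1 + rho * cos phi) (y2 + rho * sin phi))).
  intros U f g x hf hg. ct.
Qed.

(** The angle carried by the field is the direction from the center to the point, so radial
    differentiation is exactly [line_derive]. *)
Lemma circle_sum_derive H H' y1 y2 rho :
  jcont3 H -> jcont3 H' -> line_derive H H' ->
  is_derive (circle_sum H y1 y2) rho (circle_sum H' y1 y2 rho).
Proof.
  intros Hc Hc' Hd.
  apply (is_derive_RInt_jcont
     (fun rho phi => H phi (y1 + rho * cos phi) (y2 + rho * sin phi))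
     (fun rho phi => H' phi (y1 + rho * cos phi) (y2 + rho * sin phi))).
  - intros s phi. apply Hd.
  - intros U f g x hf hg. ct.
  - intros U f g x hf hg. ct.
Qed.

(** The component of y + rho theta along theta is theta.y + rho > -1 + 2, so the point lies outside
    the disk. *)
Lemma circle_sum_far H y1 y2 rho :
  disk_supported H -> y1 ^ 2 + y2 ^ 2 < 1 -> 2 <= rho -> circle_sum H y1 y2 rho = 0.
Proof.
  intros Hs hy hr. assert (hpi := PI_RGT_0).
  apply RIntR_zero; [lra|]. intros phi _. apply Hs.
  assert (B := trig_proj_bound phi y1 y2 hy).
  assert (E := trig_proj_sq phi (y1 + rho * cos phi) (y2 + rho * sin phi)).
  rewrite <- E.
  replace (cos phi * (y1 + rho * cos phi) + sin phi * (y2 + rho * sin phi))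
    with (cos phi * y1 + sin phi * y2 + rho).
  2: { assert (E2 := sin2_cos2 phi). unfold Rsqr in E2.
       transitivity (cos phi * y1 + sin phi * y2 + rho * (sin phi * sin phi + cos phi * cos phi));
         [rewrite E2|]; ring. }
  assert (h := pow2_ge_0 (- sin phi * (y1 + rho * cos phi) + cos phi * (y2 + rho * sin phi))).
  nra.
Qed.

Lemma line_derive_opposite H H' phi x y :
  (forall phi psi x y, H phi x y = H psi x y) -> line_derive H H' ->
  H' (phi + PI) x y = - H' phi x y.
Proof.
  intros Hi Hd.
  assert (A := Hd (phi + PI) x y 0). assert (B := Hd phi x y (- 0)).
  rewrite Ropp_0, !Rmult_0_l, !Rplus_0_r in *.
  assert (C : is_derive (fun s => H phi (x + - s * cos phi) (y + - s * sin phi)) 0 (- 1 * H' phi x y)).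
  { apply (is_derive_comp (V := R_NormedModule)
       (fun s => H phi (x + s * cos phi) (y + s * sin phi)) (fun s => - s)).
    - rewrite Ropp_0. exact B.
    - auto_derive; [auto|ring]. }
  rewrite <- (is_derive_unique _ _ _ A).
  transitivity (- 1 * H' phi x y); [|ring]. rewrite <- (is_derive_unique _ _ _ C).
  apply Derive_ext. intros s. rewrite neg_cos, neg_sin. rewrite (Hi (phi + PI) phi). f_equal; ring.
Qed.

(** For a field independent of the angle, opposite directions give opposite derivatives. Shifting
    the angle by pi therefore changes the sign of an integral over a full period. *)
Lemma circle_sum_derive_0 H H' y1 y2 :
  (forall phi psi x y, H phi x y = H psi x y) -> line_derive H H' -> jcont3 H' ->
  circle_sum H' y1 y2 0 = 0.
Proof.
  intros Hi Hd Hc. unfold circle_sum.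
  rewrite (RIntR_ext_all _ (fun phi => H' phi y1 y2))
    by (intros; rewrite !Rmult_0_l, !Rplus_0_r; reflexivity).
  assert (C : jcont1 (fun phi => H' phi y1 y2)) by (intros x; ct).
  assert (O := fun phi => line_derive_opposite H H' phi y1 y2 Hi Hd).
  assert (E := RIntR_periodic (fun phi => H' phi y1 y2) (2 * PI) PI C).
  assert (E2 : RInt (fun phi => H' (phi + PI) y1 y2) 0 (2 * PI)
               = (-1) * RInt (fun phi => H' phi y1 y2) 0 (2 * PI) :> R).
  { rewrite <- RIntR_scal by exact C. apply RIntR_ext_all. intros phi. rewrite O. ring. }
  cbv beta in E. rewrite E2 in E. cut (-1 * RInt (fun phi => H' phi y1 y2) 0 (2 * PI)
               = RInt (fun phi => H' phi y1 y2) 0 (2 * PI) :> R); [intros; lra|].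
  apply E. intros phi. replace (phi + 2 * PI) with (phi + PI + PI) by ring. rewrite !O. ring.
Qed.

Lemma polar_angle u s : u <> 0 ->
  exists beta, u = sqrt (u ^ 2 + s ^ 2) * cos beta /\ s = sqrt (u ^ 2 + s ^ 2) * sin beta.
Proof.
  intros hu.
  assert (hr : 0 < sqrt (1 + (s / u)²)).
  { apply sqrt_lt_R0. assert (h := Rle_0_sqr (s / u)). lra. }
  assert (E : sqrt (u ^ 2 + s ^ 2) = Rabs u * sqrt (1 + (s / u)²)).
  { rewrite <- sqrt_Rsqr_abs, <- sqrt_mult_alt by apply Rle_0_sqr.
    f_equal. unfold Rsqr. field. exact hu. }
  rewrite E. destruct (Rdichotomy _ _ hu) as [h|h].
  - exists (atan (s / u) + PI). rewrite neg_cos, neg_sin, cos_atan, sin_atan, Rabs_left by exact h.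
    split; field; lra.
  - exists (atan (s / u)). rewrite cos_atan, sin_atan, Rabs_right by lra.
    split; field; lra.
Qed.

(** In polar form u theta + s theta_perp is rho times the unit vector at angle phi + beta, and a
    shift of the angle leaves an integral over the period unchanged. *)
Lemma circle_sum_rotate H y1 y2 u s :
  jcont3 H -> (forall phi psi x y, H phi x y = H psi x y) -> u <> 0 ->
  RInt (fun phi => H phi (y1 + (u * cos phi - s * sin phi)) (y2 + (u * sin phi + s * cos phi))) 0 (2 * PI)
  = circle_sum H y1 y2 (sqrt (u ^ 2 + s ^ 2)) :> R.
Proof.
  intros Hc Hi hu. destruct (polar_angle u s hu) as [beta [Eu Es]].
  set (rho := sqrt (u ^ 2 + s ^ 2)) in *. clearbody rho. subst u s. unfold circle_sum.
  rewrite <- (RIntR_periodic (fun phi => H phi (y1 + rho * cos phi) (y2 + rho * sin phi)) (2 * PI) beta).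
  - apply RIntR_ext_all. intros phi. rewrite (Hi phi (phi + beta)), cos_plus, sin_plus.
    f_equal; ring.
  - intros x. ct.
  - intros x. assert (E1 := cos_period x 1). assert (E2 := sin_period x 1). simpl in E1, E2.
    rewrite Rmult_1_r in E1, E2. rewrite E1, E2. apply Hi.
Qed.

Definition radon_sum (H : R -> R -> R -> R) (y1 y2 u : R) : R :=
  RInt (fun phi => radon H phi (cos phi * y1 + sin phi * y2 + u)) 0 (2 * PI).

Lemma radon_sum_cont H y1 y2 : jcont3 H -> jcont1 (radon_sum H y1 y2).
Proof.
  intros Hc. assert (Hr := radon_jcont H Hc).
  apply (jcont1_RInt (fun u phi => radon H phi (cos phi * y1 + sin phi * y2 + u))).
  intros U f g x hf hg. ct.
Qed.

Lemma radon_sum_derive H H' y1 y2 u :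
  jcont3 H -> jcont3 H' -> line_derive H H' ->
  is_derive (radon_sum H y1 y2) u (radon_sum H' y1 y2 u).
Proof.
  intros Hc Hc' Hd. assert (Hr := radon_jcont H Hc). assert (Hr' := radon_jcont H' Hc').
  apply (is_derive_RInt_jcont
     (fun u phi => radon H phi (cos phi * y1 + sin phi * y2 + u))
     (fun u phi => radon H' phi (cos phi * y1 + sin phi * y2 + u))).
  - intros z phi.
    rewrite <- (Rmult_1_l (radon H' phi _)).
    apply (is_derive_comp (V := R_NormedModule) (radon H phi) (fun z => cos phi * y1 + sin phi * y2 + z)).
    + apply radon_derive; assumption.
    + auto_derive; [auto|ring].
  - intros U f g x hf hg. ct.
  - intros U f g x hf hg. ct.
Qed.

Lemma radon_sum_far H y1 y2 u :
  disk_supported H -> y1 ^ 2 + y2 ^ 2 < 1 -> 2 <= Rabs u -> radon_sum H y1 y2 u = 0.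
Proof.
  intros Hs hy hu. assert (hpi := PI_RGT_0).
  apply RIntR_zero; [lra|]. intros phi _. apply radon_support; [exact Hs|].
  assert (B := trig_proj_bound phi y1 y2 hy).
  destruct (Rle_dec 0 u) as [h|h].
  - rewrite Rabs_right in hu by lra. rewrite Rabs_right; lra.
  - rewrite Rabs_left in hu by lra. rewrite Rabs_left; lra.
Qed.

(** Each line at signed distance [u] from [y] is parametrized from the foot of the perpendicular
    from [y], which shifts [s] by b = theta_perp.y. Exchanging the integrals then leaves, for each
    [s], a sum over a circle about [y]. *)
Lemma radon_sum_radial H y1 y2 u :
  jcont3 H -> (forall phi psi x y, H phi x y = H psi x y) -> disk_supported H ->
  y1 ^ 2 + y2 ^ 2 < 1 -> u <> 0 ->
  radon_sum H y1 y2 u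
  = RInt (fun s => circle_sum H y1 y2 (sqrt (u ^ 2 + s ^ 2))) (-2) 2.
Proof.
  intros Hc Hi Hs hy hu. unfold radon_sum.
  transitivity (RInt (fun phi => RInt (fun s =>
     H phi (y1 + (u * cos phi - s * sin phi)) (y2 + (u * sin phi + s * cos phi))) (-2) 2) 0 (2 * PI)).
  - apply RIntR_ext_all. intros phi.
    set (a := cos phi * y1 + sin phi * y2). set (b := - sin phi * y1 + cos phi * y2).
    assert (Eab := trig_proj_sq phi y1 y2). fold a b in Eab.
    set (q := fun s => H phi (- s * sin phi + (a + u) * cos phi) (s * cos phi + (a + u) * sin phi)).
    unfold radon. fold q. rewrite <- (RIntR_shift_support q b).
    + apply RIntR_ext_all. intros s. unfold q.
      assert (E := sin2_cos2 phi). unfold Rsqr in E.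
      f_equal.
      * transitivity (y1 * (sin phi * sin phi + cos phi * cos phi) + (u * cos phi - s * sin phi));
          [unfold a, b; ring|rewrite E; ring].
      * transitivity (y2 * (sin phi * sin phi + cos phi * cos phi) + (u * sin phi + s * cos phi));
          [unfold a, b; ring|rewrite E; ring].
    + intros x. unfold q. ct.
    + assert (b ^ 2 < 1) by nra. nra.
    + intros s h. apply Hs. rewrite trig_norm. apply Rabs_ge1_sq in h.
      assert (h' := pow2_ge_0 (a + u)). lra.
  - rewrite (RInt_Fubini (fun phi s =>
      H phi (y1 + (u * cos phi - s * sin phi)) (y2 + (u * sin phi + s * cos phi)))).
    + apply RIntR_ext_all. intros s. apply circle_sum_rotate; assumption.
    + intros U f g x hf hg. ct.
Qed.

(** * Inversion *)

(** The chain rule gives (u / rho) m1 (rho) = u k (rho) with rho = sqrt (u^2 + s^2); u <> 0 keeps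
    rho positive for every [s], including s = 0. *)
Lemma is_derive_circle_family (m0 m1 k : R -> R) (a b u : R) :
  jcont1 k -> (forall x, is_derive m0 x (m1 x)) ->
  (forall x, 0 <= x -> m1 x = x * k x) -> u <> 0 ->
  is_derive (fun u => RInt (fun s => m0 (sqrt (u ^ 2 + s ^ 2))) a b) u
            (u * RInt (fun s => k (sqrt (u ^ 2 + s ^ 2))) a b).
Proof.
  intros Ck D E hu.
  assert (C0 : jcont1 m0) by (intros x; eapply is_derive_cont, D).
  rewrite <- RIntR_scal by (intros s; ct).
  apply (is_derive_RInt_param_loc (fun u s => m0 (sqrt (u ^ 2 + s ^ 2)))
           (fun u s => u * k (sqrt (u ^ 2 + s ^ 2))) a b u (Rabs u)).
  - apply Rabs_pos_lt, hu.
  - intros y t hy.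
    assert (hy0 : y <> 0).
    { intros ->. rewrite Rminus_0_l, Rabs_Ropp in hy. lra. }
    assert (hp : 0 < y ^ 2 + t ^ 2).
    { assert (h1 := pow2_gt_0 y hy0). assert (h2 := pow2_ge_0 t). lra. }
    assert (hs := sqrt_lt_R0 _ hp).
    replace (y * k (sqrt (y ^ 2 + t ^ 2)))
      with (y / sqrt (y ^ 2 + t ^ 2) * m1 (sqrt (y ^ 2 + t ^ 2)))
      by (rewrite E by lra; field; lra).
    apply (is_derive_comp (V := R_NormedModule) m0 (fun y => sqrt (y ^ 2 + t ^ 2))); [apply D|].
    auto_derive; change (y * (y * 1) + t * (t * 1)) with (y ^ 2 + t ^ 2).
    + lra.
    + field. lra.
  - intros y _ t. ct.
  - intros t. ct.
Qed.

Lemma log_backproj_value H0 H1 H2 H3 y1 y2 :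
  jcont3 H0 -> jcont3 H1 -> jcont3 H2 -> jcont3 H3 ->
  disk_supported H0 -> disk_supported H1 -> disk_supported H2 ->
  line_derive H0 H1 -> line_derive H1 H2 -> line_derive H2 H3 ->
  (forall phi psi x y, H0 phi x y = H0 psi x y) ->
  y1 ^ 2 + y2 ^ 2 < 1 ->
  log_backproj (fun _ => -2) (radon H3) y1 y2 = 8 * PI ^ 2 * H0 0 y1 y2.
Proof.
  intros C0 C1 C2 C3 S0 S1 S2 L0 L1 L2 Hi hy.
  assert (R3 := radon_jcont H3 C3). assert (He := elog_cont). assert (hpi := PI_RGT_0).
  set (m0 := circle_sum H0 y1 y2). set (m1 := circle_sum H1 y1 y2). set (m2 := circle_sum H2 y1 y2).
  assert (Cm0 : jcont1 m0) by (apply circle_sum_cont, C0).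
  assert (Cm1 : jcont1 m1) by (apply circle_sum_cont, C1).
  assert (Cm2 : jcont1 m2) by (apply circle_sum_cont, C2).
  assert (D0 : forall x, is_derive m0 x (m1 x)) by (intros; apply circle_sum_derive; assumption).
  assert (D1 : forall x, is_derive m1 x (m2 x)) by (intros; apply circle_sum_derive; assumption).
  (* The quotient m1 (rho) / rho in a form that is continuous through rho = 0, available because m1
     vanishes at 0. *)
  set (k := fun rho => RInt (fun t => m2 (rho * t)) 0 1).
  assert (Ck : jcont1 k).
  { apply (jcont1_RInt (fun rho t => m2 (rho * t))). intros U f g x hf hg. ct. }
  assert (Ek : forall x, 0 <= x -> m1 x = x * k x).
  { intros x hx. unfold k. rewrite <- RIntR_scal by (intros t; ct).
    rewrite (RIntR_ext_all _ (fun t => x * m2 (x * t + 0)))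
      by (intros; rewrite Rplus_0_r; reflexivity).
    rewrite RIntR_comp_lin by exact Cm2.
    rewrite Rmult_0_r, Rplus_0_r, Rmult_1_r, Rplus_0_r.
    rewrite (RInt_newton m1); auto.
    replace (m1 0) with 0; [eqR; ring|].
    symmetry. apply (circle_sum_derive_0 H0); assumption. }
  assert (Zk : forall x, 2 <= x -> k x = 0).
  { intros x hx. assert (E := Ek x ltac:(lra)). unfold m1 in E.
    rewrite circle_sum_far in E by assumption.
    apply Rmult_eq_reg_l with x; lra. }
  set (kappa := fun u => RInt (fun s => k (sqrt (u ^ 2 + s ^ 2))) (-2) 2).
  assert (Ckap : jcont1 kappa).
  { apply (jcont1_RInt (fun u s => k (sqrt (u ^ 2 + s ^ 2)))). intros U f g x hf hg. ct. }
  assert (Zkap : forall u, 4 <= u ^ 2 -> kappa u = 0).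
  { intros u hu. apply RIntR_zero; [lra|]. intros s _. apply Zk.
    rewrite <- (sqrt_pow2 2) by lra. apply sqrt_le_1_alt. assert (h := pow2_ge_0 s). lra. }
  unfold log_backproj. rewrite RIntR_scal by (apply log_backproj_inner_jcont, R3).
  rewrite (RInt_Fubini (fun phi u => radon H3 phi (cos phi * y1 + sin phi * y2 + u) * elog u)).
  2: { intros U f g x hf hg. ct. }
  rewrite (RIntR_ext_all _ (fun u => radon_sum H3 y1 y2 u * elog u)).
  2: { intros u. rewrite (Rmult_comm (radon_sum _ _ _ _)). unfold radon_sum. rewrite <- RIntR_scal by (intros x; ct).
       apply RIntR_ext_all. intros; ring. }
  rewrite (elog_pairing (radon_sum H1 y1 y2) (radon_sum H2 y1 y2) _ kappa 2).
  2: lra.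
  2: { intros; apply radon_sum_derive; assumption. }
  2: { intros; apply radon_sum_derive; assumption. }
  2: { apply radon_sum_cont; assumption. }
  2: assumption.
  (* Off 0 the sum of the Radon transforms of [H0] has two expressions, one as [radon_sum] and one
     through circles; uniqueness of its derivative identifies [radon_sum H1] with [u * kappa u]. *)
  2: { intros u hu.
       rewrite <- (is_derive_unique _ _ _ (radon_sum_derive H0 H1 y1 y2 u C0 C1 L0)).
       apply is_derive_unique.
       apply (is_derive_ext_loc (fun u => RInt (fun s => m0 (sqrt (u ^ 2 + s ^ 2))) (-2) 2)).
       - apply (locally_intro u (Rabs u)); [apply Rabs_pos_lt, hu|]. intros y hy'.
         symmetry. apply radon_sum_radial; auto.
         intros ->. rewrite Rminus_0_l, Rabs_Ropp in hy'. lra.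
       - apply (is_derive_circle_family m0 m1 k); assumption. }
  2: { apply radon_sum_far; auto. rewrite Rabs_right; lra. }
  2: { apply radon_sum_far; auto. rewrite Rabs_left; lra. }
  2: { apply Zkap. lra. }
  2: { apply Zkap. lra. }
  rewrite RIntR_even; [|exact Ckap|].
  2: { intros u. unfold kappa. apply RIntR_ext_all. intros s. do 2 f_equal. ring. }
  rewrite (RIntR_ext_all kappa (fun u => 2 * RInt (fun s => k (sqrt (u ^ 2 + s ^ 2))) 0 2)).
  2: { intros u. unfold kappa.
       apply (RIntR_even (fun s => k (sqrt (u ^ 2 + s ^ 2))) 2); [intros s; ct|].
       intros s. do 2 f_equal. ring. }
  rewrite RIntR_scal.
  2: { apply (jcont1_RInt (fun u s => k (sqrt (u ^ 2 + s ^ 2)))). intros U f g x hf hg. ct. }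
  rewrite (radial_square_integral k m0 m1); auto; [|lra].
  (* The square has half-side 2, so the rays leave it at distance at least 2, where [m0] is already
     zero. *)
  rewrite (RIntR_ext_all _ (fun v => - m0 0 * / (1 + v ^ 2))).
  2: { intros v. unfold m0 at 1. rewrite circle_sum_far; auto; [unfold Rdiv; ring|].
       assert (1 <= sqrt (1 + v ^ 2)); [|lra].
       rewrite <- sqrt_1 at 1. apply sqrt_le_1_alt. assert (h := pow2_ge_0 v). lra. }
  assert (Cinv : jcont1 (fun v => / (1 + v ^ 2))).
  { intros v. ct. assert (h := pow2_ge_0 v). lra. }
  rewrite RIntR_scal by exact Cinv.
  rewrite (RInt_newton atan); auto; [|lra| |].
  2: { intros x _. apply is_derive_Reals.
       apply derivable_pt_lim_atan. }
  2: { intros x _. apply continuity_pt_filterlim, derivable_continuous_pt, derivable_pt_atan. }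
  rewrite atan_1, atan_0.
  (* Two evenness reductions and the two halves of the quarter square give a factor 8, and the
     arctangent gives pi / 4. Hence the value is -2 * 8 * (pi / 4) * (- m0 0) = 4 pi * m0 0. *)
  replace (m0 0) with (2 * PI * H0 0 y1 y2); [field|].
  unfold m0, circle_sum. symmetry.
  rewrite (RIntR_ext_all _ (fun _ => H0 0 y1 y2)).
  - rewrite RIntR_const. eqR. ring.
  - intros phi. rewrite !Rmult_0_l, !Rplus_0_r. apply Hi.
Qed.

Theorem theorem3p2 (F : R -> R -> R -> R)
  (hsmooth : Cinf F)
  (heven : forall x1 x2 x3, on_S2 x1 x2 x3 -> F x1 x2 (- x3) = F x1 x2 x3)
  (hvanish : exists delta, 0 < delta /\
      forall x1 x2 x3, on_S2 x1 x2 x3 -> Rabs x3 < delta -> F x1 x2 x3 = 0) :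
  exists G1 G2 G11 G22 : R -> R -> R,
    (forall y1 y2, y1 ^ 2 + y2 ^ 2 < 1 ->
       derivable_pt_lim (fun s => Gpot F s y2) y1 (G1 y1 y2) /\
       derivable_pt_lim (fun s => Gpot F y1 s) y2 (G2 y1 y2) /\
       derivable_pt_lim (fun s => G1 s y2) y1 (G11 y1 y2) /\
       derivable_pt_lim (fun s => G2 y1 s) y2 (G22 y1 y2)) /\
    (forall x1 x2 x3, on_S2 x1 x2 x3 -> x1 ^ 2 + x2 ^ 2 < 1 ->
       F x1 x2 x3 = Rabs x3 / (8 * PI ^ 2) * (G11 x1 x2 + G22 x1 x2)).
Proof.
  (* Three directional derivatives: one for the integration by parts, two for the Laplacian. *)
  destruct (proj_density_lines 3 F (hsmooth 3%nat) hvanish)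
    as [C0 [S0 [H1 [L0 [C1 [S1 [H2 [L1 [C2 [S2 [H3 [L2 [C3 [S3 _]]]]]]]]]]]]]].
  set (H0 := fun _ x y : R => proj_density F x y) in *.
  assert (Hpi := PI_RGT_0).
  assert (CF : jcont3 F) by exact (Ck_cont 0 F (hsmooth 0%nat)).
  assert (Hequator : forall x1 x2, on_S2 x1 x2 0 -> F x1 x2 0 = 0).
  { destruct hvanish as [d [hd Hv]]. intros x1 x2 h. apply Hv; [exact h|]. rewrite Rabs_R0. exact hd. }
  assert (HV : forall phi t, Vf F phi t = 2 * sqrt (1 - t ^ 2) * radon H0 phi t)
    by (intros; apply Vf_radon; auto).
  assert (R1 := radon_jcont H1 C1). assert (R2 := radon_jcont H2 C2). assert (R3 := radon_jcont H3 C3).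
  assert (EG : forall y1 y2, y1 ^ 2 + y2 ^ 2 < 1 ->
            Gpot F y1 y2 = log_backproj (fun _ => -2) (radon H1) y1 y2).
  { intros y1 y2 hy. unfold Gpot, log_backproj. apply Rint_RInt_ext.
    - lra.
    - assert (J := log_backproj_inner_jcont (radon H1) y1 y2 R1). intros phi. ct.
    - intros phi _. apply inner_int_radon with H0; auto. }
  assert (DR1 : forall phi t, is_derive (radon H1 phi) t (radon H2 phi t))
    by (intros; apply radon_derive; assumption).
  assert (DR2 : forall phi t, is_derive (radon H2 phi) t (radon H3 phi t))
    by (intros; apply radon_derive; assumption).
  assert (Dfst : forall b K K' y1 y2, jcont1 b -> jcont2 K -> jcont2 K' ->
     (forall phi t, is_derive (K phi) t (K' phi t)) ->
     is_derive (fun s => log_backproj b K s y2) y1 (log_backproj (fun phi => b phi * cos phi) K' y1 y2)).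
  { intros b K K' y1 y2 hb hK hK' hd.
    apply (log_backproj_derive b K K' (fun s => s) (fun _ => y2) cos); auto;
      try (intros phi s; auto_derive; [auto|ring]); intros z; ct. }
  assert (Dsnd : forall b K K' y1 y2, jcont1 b -> jcont2 K -> jcont2 K' ->
     (forall phi t, is_derive (K phi) t (K' phi t)) ->
     is_derive (fun s => log_backproj b K y1 s) y2 (log_backproj (fun phi => b phi * sin phi) K' y1 y2)).
  { intros b K K' y1 y2 hb hK hK' hd.
    apply (log_backproj_derive b K K' (fun _ => y1) (fun s => s) sin); auto;
      try (intros phi s; auto_derive; [auto|ring]); intros z; ct. }
  assert (Bc : jcont1 (fun phi => -2 * cos phi)) by (intros x; ct).
  assert (Bs : jcont1 (fun phi => -2 * sin phi)) by (intros x; ct).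
  assert (B2 : jcont1 (fun _ => -2)) by (intros x; ct).
  (* Each derivative in [y] multiplies the weight by a component of theta and raises the order of
     the derivative of the Radon transform by one. *)
  exists (log_backproj (fun phi => -2 * cos phi) (radon H2)),
         (log_backproj (fun phi => -2 * sin phi) (radon H2)),
         (log_backproj (fun phi => -2 * cos phi * cos phi) (radon H3)),
         (log_backproj (fun phi => -2 * sin phi * sin phi) (radon H3)).
  split.
  - intros y1 y2 hy.
    assert (c1 : continuous (fun s : R => s ^ 2 + y2 ^ 2) y1) by ct.
    assert (c2 : continuous (fun s : R => y1 ^ 2 + s ^ 2) y2) by ct.
    repeat split; apply is_derive_Reals.
    (* [EG] identifies the potential only inside the open disk, which suffices for a derivative at
       an interior point. *)
    + apply (is_derive_ext_loc (fun s => log_backproj (fun _ => -2) (radon H1) s y2)).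
      * generalize (locally_lt _ _ _ _ c1 hy). apply filter_imp. intros s hs. symmetry. apply EG, hs.
      * apply (Dfst (fun _ => -2)); auto.
    + apply (is_derive_ext_loc (fun s => log_backproj (fun _ => -2) (radon H1) y1 s)).
      * generalize (locally_lt _ _ _ _ c2 hy). apply filter_imp. intros s hs. symmetry. apply EG, hs.
      * apply (Dsnd (fun _ => -2)); auto.
    + apply (Dfst (fun phi => -2 * cos phi)); auto.
    + apply (Dsnd (fun phi => -2 * sin phi)); auto.
  - intros x1 x2 x3 hx hlt.
    assert (J := log_backproj_inner_jcont (radon H3) x1 x2 R3).
    assert (E : log_backproj (fun phi => -2 * cos phi * cos phi) (radon H3) x1 x2
              + log_backproj (fun phi => -2 * sin phi * sin phi) (radon H3) x1 x2
              = log_backproj (fun _ => -2) (radon H3) x1 x2).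
    { unfold log_backproj. rewrite <- RIntR_plus by (intros phi; ct).
      apply RIntR_ext_all. intros phi.
      rewrite <- Rmult_plus_distr_r. f_equal.
      assert (E2 := sin2_cos2 phi). unfold Rsqr in E2.
      transitivity (-2 * (sin phi * sin phi + cos phi * cos phi)); [ring|rewrite E2; ring]. }
    rewrite E, (log_backproj_value H0 H1 H2 H3) by auto.
    unfold on_S2 in hx.
    (* The density is computed on the upper hemisphere, so it equals F (x', |x_3|) / |x_3|; evenness
       returns the value at x_3, and |x_3| cancels against the prefactor. *)
    assert (hx3 : 0 < Rabs x3) by (apply Rabs_pos_lt; intros ->; lra).
    unfold H0. rewrite (proj_density_val F x1 x2 (Rabs x3)); [| |exact hx3].
    + replace (F x1 x2 (Rabs x3)) with (F x1 x2 x3); [field; split; lra|].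
      unfold Rabs. destruct (Rcase_abs x3); [symmetry; apply heven, hx|reflexivity].
    + rewrite pow2_abs. exact hx.
Qed.
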